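(* Each non-cyclic MP move is derived as a sequence of the primary MP move (which is non-cyclic), the non-cyclic pure sliding moves, and their inverses. Any cyclic MP move cannot be derived as a sequence of non-cyclic moves (non-cyclic MP moves, non-cyclic pure sliding moves, and their inverses). Especially, any sequence of the primary MP move, the pure sliding moves and their inverses representing a cyclic MP move must include a cyclic pure sliding move (or the inverse of one).
   Context: **Normal o-tangles.** Normal o-graphs are oriented virtual link diagrams (real crossings with sign $\pm$) considered only up to the way the ends of real crossings are connected; normal o-tangles are the local pieces of such diagrams. A normal o-tangle with boundary $(I,O)$ ($I,O$ finite labelled sets of incoming and outgoing boundary points) consists of a finite set $V$ of vertices (real crossings), each with a sign in $\{+,-\}$ and four ends over-in, over-out, under-in, under-out, together with a bijection from $\{\text{out-ends of } V\}\sqcup I$ to $\{\text{in-ends of } V\}\sqcup O$ (matched pairs are called edges), up to isomorphism fixing $I$ and $O$. A normal o-graph is a nonempty connected normal o-tangle with $I=O=\emptyset$. **Dual branched complex.** To a normal o-tangle $\tau$ associate a complex $T(\tau)$: for each vertex take a tetrahedron with ordered vertices $0<1<2<3$; let $F_i$ be the face opposite to $i$. At a positive vertex the tetrahedron is oriented so that the frame $(01,02,03)$ is negative, and over-in, over-out, under-in, under-out correspond to $F_0,F_1,F_2,F_3$. At a negative vertex the frame $(01,02,03)$ is positive, and over-in, over-out, under-in, under-out correspond to $F_1,F_0,F_3,F_2$. For each edge matching two ends of vertices glue the corresponding faces by the order-preserving affine map; edges with one end in the boundary correspond to unglued faces, and edges from $I$ to $O$ to isolated triangles with ordered vertices. So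 edges of $\tau$ correspond to triangles of $T(\tau)$. The moves below are described on $T(\tau)$; they keep $(I,O)$ and the labelling of boundary points fixed. **MP moves.** Two distinct tetrahedra glued along a triangle with vertices $c<d<e$, with remaining vertices $a,b$ (five abstractly distinct vertices of a bipyramid). Choose a total order on $\{a,b,c,d,e\}$ extending the orders of both tetrahedra, such that $a,b$ are not both smaller than $c$ and not both larger than $e$. Replace the two tetrahedra by the three tetrahedra $\{a,b,c,d\},\{a,b,d,e\},\{a,b,c,e\}$ around a new edge $ab$, with restricted orders, orientation of the bipyramid and outer gluings unchanged. Taking $a$ to be the apex for which the frame $(ac,ad,ae)$ is positive, the total orders give 16 types of MP moves. **Primary MP move.** The MP move with five vertices $v_0<v_1<v_2<v_3<v_4$, replacing $\{v_0,v_1,v_2,v_4\}$, $\{v_0,v_2,v_3,v_4\}$ by $\{v_1,v_2,v_3,v_4\}$, $\{v_0,v_1,v_3,v_4\}$, $\{v_0,v_1,v_2,v_3\}$, where all five tetrahedra correspond to positive vertices. **Pure sliding moves.** Let $E$ be an edge of $T(\tau)$ with ends $x<y$; choose triangles $f_1,f_2$ at two different places around $E$ (a triangle may first be replaced by a stack of two parallel copies, so $f_1,f_2$ may be parallel copies of one triangle; $f_1,f_2$ may be boundary triangles). Let $p,q$ be their third vertices. Choose a total order on $\{x,y,p,q\}$ (abstractly distinct vertices) compatible with $f_1,f_2$, with $p,q$ not both smaller than $x$ and not both larger than $y$. Cut open along $f_1\cup f_2$ (joined along $E$) and insert a pillow of two oppositely oriented tetrahedra, both with vertices $x,y,p,q$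 in this order, glued to each other along $xpq$ and $ypq$, the four outer faces being glued to the four sides of the cut. Up to exchanging $p,q$ the types are ps-I: $p<x<q<y$; ps-II: $x<p<y<q$; ps-III: $p<x<y<q$; ps-IV: $x<p<q<y$. **Cyclic moves.** A move is cyclic if the new 2-cell of the dual polyhedron that it creates is bounded by edges oriented cyclically. Explicitly, an MP move is cyclic if either all or none of $c,d,e$ lie strictly between $a$ and $b$ in the total order (6 of the 16 types), and non-cyclic otherwise; ps-III and ps-IV are cyclic, ps-I and ps-II are non-cyclic. The inverse of a (non-)cyclic move is also called (non-)cyclic. **Derivation.** Each type $m$ of MP move is a local replacement of a two-vertex normal o-tangle $\tau_m$ by a three-vertex normal o-tangle $\tau_m'$ with the same boundary (the two decompositions of the bipyramid). ''$m$ is derived as a sequence of moves in a set $S$'' means that $\tau_m'$ is obtained from $\tau_m$ by a finite sequence of moves in $S$ performed on normal o-tangles with that boundary. *)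

(* Defs.v *)
From mathcomp Require Import all_boot.

Set Implicit Arguments.
Unset Strict Implicit.
Unset Printing Implicit Defensive.

(* The out-ends and the in-ends of the real crossings are both indexed by
   [vert * bool], the Boolean being [true] for the over-strand and [false] for
   the under-strand.  [sgn] is [true] at positive crossings.  [conn] maps the
   source of each edge to its target, so an edge is named by its source. *)
Record otangle (I O : finType) := OTangle {
  vert : finType;
  sgn : vert -> bool;
  conn : vert * bool + I -> vert * bool + O;
  conn_bij : bijective conn }.

Definition ren (V V' : finType) (A : Type) (f : V -> V')
    (x : V * bool + A) : V' * bool + A :=
  match x with inl (v, s) => inl (f v, s) | inr a => inr a end.

(* [t] is, up to isomorphism, the tangle with vertices [V], signs [sg] and
   connections [c]; this fails as soon as [c] takes the value [None]. *)
Definition presents (I O V : finType) (sg : V -> bool)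
    (c : V * bool + I -> option (V * bool + O)) (t : otangle I O) : Prop :=
  exists f : V -> vert t,
    [/\ bijective f,
        forall v, sgn (f v) = sg v
      & forall x, omap (ren f) (c x) = Some (conn (ren f x))].

Definition iso (I O : finType) (t t' : otangle I O) : Prop :=
  presents (@sgn _ _ t) (fun x => Some (conn x)) t'.

Section Composition.

Variables I0 O0 I O : finType.

(* The boundary points of the inner tangle [u] are joined to those boundary
   points of the outer tangle [C] that lie in [O0] and [I0].  The composition
   is only used for inner tangles without an edge from [I0] to [O0]; [None]
   marks the edges of [C] that would have to be continued along such an edge. *)
Variables (C : otangle (O0 + I)%type (I0 + O)%type) (u : otangle I0 O0).

Definition enter (y : vert C * bool + (I0 + O)) :
    option ((vert C + vert u) * bool + O) :=
  match y with
  | inl (w, s) => Some (inl (inl w, s))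
  | inr (inr o) => Some (inr o)
  | inr (inl i) =>
      match conn (inr i : vert u * bool + I0) with
      | inl (w, s) => Some (inl (inr w, s))
      | inr _ => None
      end
  end.

Definition plug_conn (x : (vert C + vert u) * bool + I) :
    option ((vert C + vert u) * bool + O) :=
  match x with
  | inl (inl v, s) => enter (conn (inl (v, s)))
  | inr i => enter (conn (inr (inr i)))
  | inl (inr v, s) =>
      match conn (inl (v, s) : vert u * bool + I0) with
      | inl (w, r) => Some (inl (inr w, r))
      | inr o => enter (conn (inr (inl o)))
      end
  end.

Definition plug_sgn (v : vert C + vert u) : bool :=
  match v with inl w => sgn w | inr w => sgn w end.

Definition plugged (t : otangle I O) : Prop := presents plug_sgn plug_conn t.

End Composition.

Definition replaces (I0 O0 I O : finType) (u u' : otangle I0 O0)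
    (t t' : otangle I O) : Prop :=
  exists C : otangle (O0 + I)%type (I0 + O)%type,
    plugged C u t /\ plugged C u' t'.

(* Faces of the ordered tetrahedra 0 < 1 < 2 < 3; F_i is opposite to i, and its
   vertices, in order, are [lift i 0], [lift i 1], [lift i 2]. *)
Definition F0 : 'I_4 := @Ordinal 4 0 isT.
Definition F1 : 'I_4 := @Ordinal 4 1 isT.
Definition F2 : 'I_4 := @Ordinal 4 2 isT.
Definition F3 : 'I_4 := @Ordinal 4 3 isT.

Definition in_face (sg over : bool) : 'I_4 :=
  match sg, over with
  | true, true => F0 | true, false => F2
  | false, true => F1 | false, false => F3
  end.

Definition out_face (sg over : bool) : 'I_4 :=
  match sg, over with
  | true, true => F1 | true, false => F3
  | false, true => F0 | false, false => F2
  end.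

(* A type of MP moves.  The vertices of the bipyramid are identified with their
   ranks in the chosen total order. *)
Record mp_type := MpType {
  va : 'I_5; vb : 'I_5; vc : 'I_5; vd : 'I_5; ve : 'I_5;
  mp_ok : [&& uniq [:: va; vb; vc; vd; ve], vc < vd, vd < ve,
              ~~ ((va < vc) && (vb < vc)) & ~~ ((ve < va) && (ve < vb))] }.

Section Bipyramid.

Variable m : mp_type.
Let a := va m.
Let b := vb m.
Let c := vc m.
Let d := vd m.
Let e := ve m.

(* Each of the five tetrahedra is named by the vertex it omits: [b] and [a] are
   the two tetrahedra, and [e], [c], [d] the three tetrahedra, of the
   bipyramid. *)
Definition tets (two : bool) : seq 'I_5 :=
  if two then [:: a; b] else [:: c; d; e].

(* An enumeration u0, u1, u2, u3 of the vertices of the tetrahedron omitting [i]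
   for which the frame (u0u1, u0u2, u0u3) is positive.  That (ac, ad, ae) is
   positive is the convention on [a] and [b]; as [b] is on the other side of
   cde, (bc, bd, be) is negative; as the segment ab crosses cde, [b] may replace
   any one of [c], [d], [e] in (ac, ad, ae). *)
Definition pos_frame (i : 'I_5) : seq 'I_5 :=
  if i == b then [:: a; c; d; e]
  else if i == a then [:: b; d; c; e]
  else if i == c then [:: a; b; d; e]
  else if i == d then [:: a; c; b; e]
  else [:: a; c; d; b].

Fixpoint inversions (s : seq 'I_5) : nat :=
  if s is x :: s' then count (fun y : 'I_5 => y < x) s' + inversions s' else 0.

(* The crossing is positive when the frame (01, 02, 03) of the ordered
   tetrahedron is negative. *)
Definition tet_sgn (i : 'I_5) : bool := odd (inversions (pos_frame i)).

Definition opp_in (i : 'I_5) (s : bool) : 'I_5 := lift i (in_face (tet_sgn i) s).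
Definition opp_out (i : 'I_5) (s : bool) : 'I_5 :=
  lift i (out_face (tet_sgn i) s).

Definition in_tri (i : 'I_5) (s : bool) : {set 'I_5} := ~: [set i; opp_in i s].
Definition out_tri (i : 'I_5) (s : bool) : {set 'I_5} :=
  ~: [set i; opp_out i s].

(* The incoming and the outgoing boundary triangles of the bipyramid, named by
   their vertex sets and read off from the decomposition in two tetrahedra. *)
Definition is_mp_in (f : {set 'I_5}) : bool :=
  [exists i in tets true, exists s,
     (opp_in i s \in tets false) && (f == in_tri i s)].
Definition is_mp_out (f : {set 'I_5}) : bool :=
  [exists i in tets true, exists s,
     (opp_out i s \in tets false) && (f == out_tri i s)].

Definition mp_in : finType := {f : {set 'I_5} | is_mp_in f}.
Definition mp_out : finType := {f : {set 'I_5} | is_mp_out f}.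

Section Side.

Variable two : bool.

Definition tet : finType := {i : 'I_5 | i \in tets two}.

(* The triangle of the bipyramid at which an edge starts, resp. ends. *)
Definition src_tri (x : tet * bool + mp_in) : {set 'I_5} :=
  match x with inl (v, s) => out_tri (val v) s | inr f => val f end.
Definition tgt_tri (y : tet * bool + mp_out) : {set 'I_5} :=
  match y with inl (v, s) => in_tri (val v) s | inr f => val f end.

End Side.
End Bipyramid.

Lemma ord5_ind (P : 'I_5 -> Prop) :
  P (@Ordinal 5 0 isT) -> P (@Ordinal 5 1 isT) -> P (@Ordinal 5 2 isT) ->
  P (@Ordinal 5 3 isT) -> P (@Ordinal 5 4 isT) -> forall i, P i.
Proof.
move=> P0 P1 P2 P3 P4 [[|[|[|[|[|n]]]]] lti] //;
  by rewrite (bool_irrelevance lti isT).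
Qed.

Definition nb_in m (i j : 'I_5) : bool :=
  (opp_in m i true == j) || (opp_in m i false == j).
Definition nb_out m (i j : 'I_5) : bool :=
  (opp_out m i true == j) || (opp_out m i false == j).

Lemma mp_table m i j :
  (i != j) ==>
  [&& nb_out m i j == ~~ nb_in m i j,
      nb_in m i j ==
        ((i \in tets m true) == (j \in tets m true)) (+) nb_in m j i,
      (i \in tets m false) == (i \notin tets m true),
      opp_in m i true != opp_in m i false
    & opp_out m i true != opp_out m i false].
Proof.
case: m => a b c d e.
elim/ord5_ind: a; elim/ord5_ind: b;
  try (by move=> ok; exfalso; vm_compute in ok);
elim/ord5_ind: c; try (by move=> ok; exfalso; vm_compute in ok);
elim/ord5_ind: d; try (by move=> ok; exfalso; vm_compute in ok);
elim/ord5_ind: e; try (by move=> ok; exfalso; vm_compute in ok);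
move=> ok; elim/ord5_ind: i; elim/ord5_ind: j; vm_compute; reflexivity.
Qed.

Section Glue.
Variable m : mp_type.
Implicit Types (i j : 'I_5) (s t : bool).

Lemma opp_in_neq i s : i != opp_in m i s. Proof. exact: neq_lift. Qed.
Lemma opp_out_neq i s : i != opp_out m i s. Proof. exact: neq_lift. Qed.

Lemma nb_inP i j : reflect (exists s, opp_in m i s = j) (nb_in m i j).
Proof.
apply: (iffP orP) => [[/eqP <-|/eqP <-]|[[] <-]];
  by [exists true|exists false|left|right].
Qed.
Lemma nb_outP i j : reflect (exists s, opp_out m i s = j) (nb_out m i j).
Proof.
apply: (iffP orP) => [[/eqP <-|/eqP <-]|[[] <-]];
  by [exists true|exists false|left|right].
Qed.

Lemma nb_outE i j : i != j -> nb_out m i j = ~~ nb_in m i j.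
Proof. by move=> ij; have /implyP/(_ ij)/and5P[/eqP] := mp_table m i j. Qed.

Lemma tetsN two i : (i \in tets m (~~ two)) = (i \notin tets m two).
Proof.
have H : (i \in tets m false) = (i \notin tets m true).
  have /implyP := mp_table m i (lift i ord0).
  by move=> /(_ (neq_lift _ _))/and5P[_ _ /eqP].
by case: two => //=; rewrite H negbK.
Qed.

Lemma nb_in_sym two i j : i != j -> i \in tets m two ->
  nb_in m j i = (j \in tets m two) (+) nb_in m i j.
Proof.
move=> ij iS; have /implyP/(_ ij)/and5P[_ /eqP-> _ _ _] := mp_table m i j.
have H k : (k \in tets m false) = (k \notin tets m true) := tetsN true k.
case: two iS; rewrite ?H => iS; rewrite ?(negPf iS) ?iS.
  by case: (j \in _) (nb_in m j i) => [] [].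
by case: (j \in _) (nb_in m j i) => [] [].
Qed.

Lemma nb_out_sym two i j : i != j -> i \in tets m two ->
  nb_out m j i = (j \in tets m two) (+) nb_out m i j.
Proof.
move=> ij iS; have ji : j != i by rewrite eq_sym.
by rewrite (nb_outE ij) (nb_outE ji) (nb_in_sym ij iS) addbN.
Qed.

Lemma opp_in_inj i : injective (opp_in m i).
Proof.
have /implyP/(_ (neq_lift _ _))/and5P[_ _ _ ne _] := mp_table m i (lift i ord0).
by move=> [] [] // /eqP; rewrite ?(eq_sym (opp_in m i false)) (negPf ne).
Qed.
Lemma opp_out_inj i : injective (opp_out m i).
Proof.
have /implyP/(_ (neq_lift _ _))/and5P[_ _ _ _ ne] := mp_table m i (lift i ord0).
by move=> [] [] // /eqP; rewrite ?(eq_sym (opp_out m i false)) (negPf ne).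
Qed.

Lemma setC2_inj i j k l : i != j -> ~: [set i; j] = ~: [set k; l] ->
  (i = k /\ j = l) \/ (i = l /\ j = k).
Proof.
move=> ij /setC_inj E.
have : i \in [set k; l] by rewrite -E !inE eqxx.
have : j \in [set k; l] by rewrite -E !inE eqxx orbT.
have : k \in [set i; j] by rewrite E !inE eqxx.
have : l \in [set i; j] by rewrite E !inE eqxx orbT.
rewrite !inE => Hl Hk /orP[]/eqP jE /orP[]/eqP iE; try by [left|right].
- by rewrite iE jE eqxx in ij.
- by rewrite iE jE eqxx in ij.
Qed.

Lemma is_mp_inP two f : reflect
  (exists i j, [/\ i \in tets m two, j \notin tets m two,
     nb_in m i j & f = ~: [set i; j]]) (is_mp_in m f).
Proof.
have tab : reflect (exists i j, [/\ i \in tets m true, j \notin tets m true,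
     nb_in m i j & f = ~: [set i; j]]) (is_mp_in m f).
  apply: (iffP exists_inP) => [[i iS /existsP[s /andP[jS /eqP->]]]|].
    exists i, (opp_in m i s); split=> //; first by rewrite -(tetsN true).
    by apply/nb_inP; exists s.
  move=> [i [j [iS jS /nb_inP[s sj] ->]]]; exists i => //; apply/existsP.
  by exists s; rewrite sj (tetsN true) jS /in_tri sj eqxx.
case: two => //; apply: (iffP tab) => -[i [j [iS jS n ->]]]; exists j, i.
  have ij : i != j by apply: contraNneq jS => <-.
  have jF : j \in tets m false by rewrite (tetsN true).
  split=> //; first by rewrite (tetsN true) negbK.
    by rewrite (nb_in_sym ij iS) (negPf jS).
  by rewrite setUC.
have ij : i != j by apply: contraNneq jS => <-.
have jT : j \in tets m true by move: jS; rewrite (tetsN true) negbK.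
split=> //; first by rewrite -(tetsN true).
  by rewrite (nb_in_sym ij iS) (negPf jS).
by rewrite setUC.
Qed.

Lemma is_mp_outP two f : reflect
  (exists i j, [/\ i \in tets m two, j \notin tets m two,
     nb_out m i j & f = ~: [set i; j]]) (is_mp_out m f).
Proof.
have tab : reflect (exists i j, [/\ i \in tets m true, j \notin tets m true,
     nb_out m i j & f = ~: [set i; j]]) (is_mp_out m f).
  apply: (iffP exists_inP) => [[i iS /existsP[s /andP[jS /eqP->]]]|].
    exists i, (opp_out m i s); split=> //; first by rewrite -(tetsN true).
    by apply/nb_outP; exists s.
  move=> [i [j [iS jS /nb_outP[s sj] ->]]]; exists i => //; apply/existsP.
  by exists s; rewrite sj (tetsN true) jS /out_tri sj eqxx.
case: two => //; apply: (iffP tab) => -[i [j [iS jS n ->]]]; exists j, i.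
  have ij : i != j by apply: contraNneq jS => <-.
  have jF : j \in tets m false by rewrite (tetsN true).
  split=> //; first by rewrite (tetsN true) negbK.
    by rewrite (nb_out_sym ij iS) (negPf jS).
  by rewrite setUC.
have ij : i != j by apply: contraNneq jS => <-.
have jT : j \in tets m true by move: jS; rewrite (tetsN true) negbK.
split=> //; first by rewrite -(tetsN true).
  by rewrite (nb_out_sym ij iS) (negPf jS).
by rewrite setUC.
Qed.

Variable two : bool.
Notation src := (tet m two * bool + mp_in m)%type.
Notation tgt := (tet m two * bool + mp_out m)%type.

Let mkt i (iS : i \in tets m two) : tet m two :=
  exist (fun i => is_true (i \in tets m two)) i iS.

Lemma src_tri_inj : injective (@src_tri m two).
Proof.
have mix v s f : is_mp_in m f -> v \in tets m two -> out_tri m v s <> f.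
  move=> /(is_mp_inP two)[i [j [iS jS n ->]]] vS E.
  have vo : nb_out m v (opp_out m v s) by apply/nb_outP; exists s.
  have [[Ei Ej]|[Ei Ej]] := setC2_inj (opp_out_neq v s) E.
    move: vo; rewrite Ej Ei nb_outE ?n//.
    by apply: contraNneq jS => <-.
  by rewrite -Ei vS in jS.
move=> [[v s]|f] [[w t]|g] /= E.
- have [[Ei Ej]|[Ei Ej]] := setC2_inj (opp_out_neq _ s) E.
    have Evw : v = w by apply: val_inj.
    by rewrite -Evw in Ej *; rewrite (opp_out_inj Ej).
  have vo : nb_out m (val v) (opp_out m (val v) s) by apply/nb_outP; exists s.
  have wo : nb_out m (val w) (opp_out m (val w) t) by apply/nb_outP; exists t.
  move: vo wo; rewrite Ej -Ei => vo wo.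
  have := opp_out_neq (val v) s; rewrite Ej => vw.
  by move: wo; rewrite (nb_out_sym vw (valP v)) (valP w) vo.
- by case: (mix _ _ _ (valP g) (valP v) E).
- by case: (mix _ _ _ (valP f) (valP w) (esym E)).
- by congr inr; apply: val_inj.
Qed.

Lemma tgt_tri_inj : injective (@tgt_tri m two).
Proof.
have mix v s f : is_mp_out m f -> v \in tets m two -> in_tri m v s <> f.
  move=> /(is_mp_outP two)[i [j [iS jS n ->]]] vS E.
  have vo : nb_in m v (opp_in m v s) by apply/nb_inP; exists s.
  have [[Ei Ej]|[Ei Ej]] := setC2_inj (opp_in_neq v s) E.
    move: n; rewrite -Ej -Ei nb_outE ?vo//; exact: opp_in_neq.
  by rewrite -Ei vS in jS.
move=> [[v s]|f] [[w t]|g] /= E.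
- have [[Ei Ej]|[Ei Ej]] := setC2_inj (opp_in_neq _ s) E.
    have Evw : v = w by apply: val_inj.
    by rewrite -Evw in Ej *; rewrite (opp_in_inj Ej).
  have vo : nb_in m (val v) (opp_in m (val v) s) by apply/nb_inP; exists s.
  have wo : nb_in m (val w) (opp_in m (val w) t) by apply/nb_inP; exists t.
  move: vo wo; rewrite Ej -Ei => vo wo.
  have := opp_in_neq (val v) s; rewrite Ej => vw.
  by move: wo; rewrite (nb_in_sym vw (valP v)) (valP w) vo.
- by case: (mix _ _ _ (valP g) (valP v) E).
- by case: (mix _ _ _ (valP f) (valP w) (esym E)).
- by congr inr; apply: val_inj.
Qed.

Lemma src_triP (x : src) : exists y : tgt, tgt_tri y == src_tri x.
Proof.
case: x => [[v s]|f] /=.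
  have vo : nb_out m (val v) (opp_out m (val v) s) by apply/nb_outP; exists s.
  have vj := opp_out_neq (val v) s.
  have [jS|jS] := boolP (opp_out m (val v) s \in tets m two).
    have : nb_in m (opp_out m (val v) s) (val v).
      by rewrite (nb_in_sym vj (valP v)) jS /= -nb_outE.
    move=> /nb_inP[t tE]; exists (inl (mkt jS, t)) => /=.
    by rewrite /in_tri tE setUC.
  have fP : is_mp_out m (out_tri m (val v) s).
    apply/(is_mp_outP two); exists (val v), (opp_out m (val v) s).
    by split=> //; exact: valP.
  by exists (inr (exist (fun f => is_true (_ f)) _ fP)).
have /(is_mp_inP two)[i [j [iS jS /nb_inP[s E] fE]]] := valP f.
by exists (inl (mkt iS, s)); rewrite /= fE /in_tri E.
Qed.

Lemma tgt_triP (y : tgt) : exists x : src, src_tri x == tgt_tri y.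
Proof.
case: y => [[v s]|f] /=.
  have vo : nb_in m (val v) (opp_in m (val v) s) by apply/nb_inP; exists s.
  have vj := opp_in_neq (val v) s.
  have [jS|jS] := boolP (opp_in m (val v) s \in tets m two).
    have : nb_out m (opp_in m (val v) s) (val v).
      by rewrite (nb_out_sym vj (valP v)) jS /= nb_outE // negbK.
    move=> /nb_outP[t tE]; exists (inl (mkt jS, t)) => /=.
    by rewrite /out_tri tE setUC.
  have fP : is_mp_in m (in_tri m (val v) s).
    apply/(is_mp_inP two); exists (val v), (opp_in m (val v) s).
    by split=> //; exact: valP.
  by exists (inr (exist (fun f => is_true (_ f)) _ fP)).
have /(is_mp_outP two)[i [j [iS jS /nb_outP[s E] fE]]] := valP f.
by exists (inl (mkt iS, s)); rewrite /= fE /out_tri E.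
Qed.

(* An edge of the decomposition is a triangle: its source and its target are the
   ends at the same triangle. *)
Definition piece_conn (x : src) : tgt := xchoose (src_triP x).

Lemma piece_connE x : tgt_tri (piece_conn x) = src_tri x.
Proof. exact/eqP/(xchooseP (src_triP x)). Qed.

Lemma piece_conn_bij : bijective piece_conn.
Proof.
exists (fun y => xchoose (tgt_triP y)) => z.
  by apply: src_tri_inj; rewrite (eqP (xchooseP (tgt_triP _))) piece_connE.
by apply: tgt_tri_inj; rewrite piece_connE (eqP (xchooseP (tgt_triP z))).
Qed.
Lemma piece_conn_arcless f : if piece_conn (inr f) is inr _ then false else true.
Proof.
case E: (piece_conn _) => [//|g]; have := piece_connE (inr f); rewrite E /=.
have /(is_mp_inP true)[i [j [iS jS n ->]]] := valP f.
have /(is_mp_outP true)[k [l [kS lS n' ->]]] := valP g => E'.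
have kl : k != l by apply: contraNneq lS => <-.
have [[Ei Ej]|[Ei Ej]] := setC2_inj kl E'.
  by move: n'; rewrite nb_outE // Ei Ej n.
by rewrite Ei (negPf jS) in kS.
Qed.

Definition piece : otangle (mp_in m) (mp_out m) :=
  OTangle (fun v : tet m two => tet_sgn m (val v)) piece_conn_bij.

End Glue.

(* The tangles tau_m and tau_m' of the type [m]. *)
Definition mp_src (m : mp_type) : otangle (mp_in m) (mp_out m) := piece m true.
Definition mp_tgt (m : mp_type) : otangle (mp_in m) (mp_out m) := piece m false.

Definition mp_step (m : mp_type) (I O : finType) (t t' : otangle I O) : Prop :=
  replaces (mp_src m) (mp_tgt m) t t'.

(* Of v0 < ... < v4, the tetrahedra v0v1v2v4 and v0v2v3v4 omit v3 and v1. *)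
Definition is_primary (m : mp_type) : bool :=
  perm_eq (tets m true) [:: @Ordinal 5 3 isT; @Ordinal 5 1 isT]
  && all (tet_sgn m) (tets m true ++ tets m false).

Definition primary_mp : mp_type :=
  @MpType (@Ordinal 5 1 isT) (@Ordinal 5 3 isT) (@Ordinal 5 0 isT)
    (@Ordinal 5 2 isT) (@Ordinal 5 4 isT) isT.

Lemma is_primaryE m : is_primary m <-> m = primary_mp.
Proof.
split; last by move=> ->; vm_compute.
case: m => a b c d e.
elim/ord5_ind: a; elim/ord5_ind: b;
  try (by move=> ok; exfalso; vm_compute in ok);
elim/ord5_ind: c; try (by move=> ok; exfalso; vm_compute in ok);
elim/ord5_ind: d; try (by move=> ok; exfalso; vm_compute in ok);
elim/ord5_ind: e; try (by move=> ok; exfalso; vm_compute in ok);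
move=> ok; try (by move=> H; exfalso; vm_compute in H).
by move=> _; rewrite (bool_irrelevance ok isT).
Qed.

(* A place is a triangle of T(t), named by the source of the corresponding edge
   of [t], together with its edge opposite to its [k]-th vertex. *)
Section Places.

Variables (I O : finType) (t : otangle I O).

Definition place : finType := ((vert t * bool + I) * 'I_3)%type.

Definition is_face (x : vert t * bool + I) (v : vert t) (f : 'I_4) : bool :=
  (if x is inl (w, s) then (w == v) && (out_face (sgn v) s == f) else false)
  || (if conn x is inl (w, s) then (w == v) && (in_face (sgn v) s == f)
      else false).

(* The edge of the tetrahedron [v] disjoint from {f, f'} is the common edge of
   its faces F_f and F_f'. *)
Definition place_adj (y y' : place) : bool :=
  [exists v, exists f, exists f',
     [&& is_face y.1 v f, is_face y'.1 v f',
         lift f y.2 == f' & lift f' y'.2 == f]].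

(* The two places are at the same edge of T(t). *)
Definition same_edge (y y' : place) : bool := connect place_adj y y'.

End Places.

Inductive ps_type := psI | psII | psIII | psIV.

(* The ranks of [p] and [q] in the total order on x, y, p, q, where x < y. *)
Definition ps_p (k : ps_type) : 'I_4 :=
  match k with psI => F0 | psII => F1 | psIII => F0 | psIV => F1 end.
Definition ps_q (k : ps_type) : 'I_4 :=
  match k with psI => F2 | psII => F3 | psIII => F3 | psIV => F2 end.

Section Slide.

Variables (I O : finType) (t : otangle I O) (k : ps_type).
Let p := ps_p k.
Let q := ps_q k.

(* The triangles f_1 = xyp and f_2 = xyq are [x1] and [x2]; when [x1] and [x2]
   are equal they are two parallel copies, and [fst1] tells whether f_1 is the
   one closer to the source of the edge.  The tetrahedra [inr true] (positive)
   and [inr false] (negative) of the pillow have one in-end and one out-end at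
   each of the four triangles, opposite to the vertices [f : 'I_4]: they are
   joined at xpq and ypq; at xyp (opposite to q) and xyq (opposite to p) the
   pillow is inserted in the edges [x1] and [x2]. *)
Variables (x1 x2 : vert t * bool + I) (fst1 : bool).

Definition slide_sgn (v : vert t + bool) : bool :=
  match v with inl w => sgn w | inr b => b end.

Definition pillow_in (f : 'I_4) : (vert t + bool) * bool + O :=
  inl (inr (~~ odd f), f < 2).

Definition slide_start (x : vert t * bool + I) : (vert t + bool) * bool + O :=
  if (x == x1) && ~~ ((x1 == x2) && ~~ fst1) then pillow_in q
  else if x == x2 then pillow_in p
  else ren inl (conn x).

Definition slide_conn (x : (vert t + bool) * bool + I) :
    (vert t + bool) * bool + O :=
  match x with
  | inl (inl v, s) => slide_start (inl (v, s))
  | inr i => slide_start (inr i)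
  | inl (inr b, s) =>
      let f := out_face b s in
      if f == q then
        if (x1 == x2) && fst1 then pillow_in p else ren inl (conn x1)
      else if f == p then
        if (x1 == x2) && ~~ fst1 then pillow_in q else ren inl (conn x2)
      else pillow_in f
  end.

End Slide.

Lemma pillow_inP (f : 'I_4) : in_face (~~ odd f) (f < 2) = f.
Proof. by case: f => [[|[|[|[|n]]]] ltf] //; apply: val_inj. Qed.

(* [k1] and [k2] are the positions of p in xyp and of q in xyq. *)
Definition ps_step (k : ps_type) (I O : finType) (t t' : otangle I O) : Prop :=
  exists (x1 x2 : vert t * bool + I) (k1 k2 : 'I_3) (fst1 : bool),
    [/\ lift (ps_q k) k1 = ps_p k, lift (ps_p k) k2 = ps_q k,
        same_edge ((x1, k1) : place t) ((x2, k2) : place t)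
      & presents (@slide_sgn _ _ t)
          (fun x => Some (slide_conn k x1 x2 fst1 x)) t'].

Inductive otmove := MP of mp_type | PS of ps_type.

Definition step (mv : otmove) (I O : finType) (t t' : otangle I O) : Prop :=
  match mv with MP m => mp_step m t t' | PS k => ps_step k t t' end.

Definition between (u v w : 'I_5) : bool := (u < w < v) || (v < w < u).

Definition mp_cyclic (m : mp_type) : bool :=
  let s := [:: vc m; vd m; ve m] in
  all (between (va m) (vb m)) s || ~~ has (between (va m) (vb m)) s.

Definition ps_cyclic (k : ps_type) : bool :=
  match k with psI | psII => false | psIII | psIV => true end.

Definition cyclic (mv : otmove) : bool :=
  match mv with MP m => mp_cyclic m | PS k => ps_cyclic k end.

Definition is_PS (mv : otmove) : bool := if mv is PS _ then true else false.

Definition is_primary_move (mv : otmove) : bool :=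
  if mv is MP m then is_primary m else false.

(* [(mv, true)] stands for the move [mv] and [(mv, false)] for its inverse. *)
Fixpoint sequence (s : seq (otmove * bool)) (I O : finType)
    (t t' : otangle I O) : Prop :=
  match s with
  | [::] => iso t t'
  | (mv, d) :: s' =>
      exists u : otangle I O,
        (if d then step mv t u else step mv u t) /\ sequence s' u t'
  end.

Definition represents_mp (s : seq (otmove * bool)) (m : mp_type) : Prop :=
  sequence s (mp_src m) (mp_tgt m).

Definition derived (m : mp_type) (S : pred otmove) : Prop :=
  exists s : seq (otmove * bool),
    all (fun r => S r.1) s /\ represents_mp s m.

(* Main.v *)
Require Import Defs.
From mathcomp Require Import all_boot zify.

Set Implicit Arguments.
Unset Strict Implicit.
Unset Printing Implicit Defensive.

(** Two independent arguments.

    Derivations: o-tangles are encoded by tables of numbers, and each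
    non-cyclic type of MP moves comes with an explicit sequence of at most six
    primary moves, sliding moves and inverses, verified by computation.

    Obstruction: follow a place (an edge of the o-tangle, i.e. a triangle of T,
    with one of its sides) along its edge into the next tetrahedron and pass to
    the other face of that tetrahedron at the same side, as long as this is an
    out-face.  This is a partial injection of the finite set of places, whose
    cycles are the interior 2-cells of the dual polyhedron with cyclically
    oriented boundary.  Non-cyclic moves preserve the existence of a cycle: the
    two sides of a non-cyclic MP move have no cycle of their own and link the
    boundary places in the same way, while a non-cyclic pillow interrupts only
    the tracks at xy, which lie on no cycle since f_1 and f_2 are crossed in
    opposite senses around xy.  Two tetrahedra glued along a triangle have no
    cycle, but the three tetrahedra of a cyclic MP move have the one around
    ab. *)

(** * Encodings of o-tangles *)

(** The last clause uses the boolean [==], so that [xchoose] extracts an inverse of [r]. *)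
Definition numbers (A : finType) (n : nat) (r : A -> nat) : Prop :=
  [/\ injective r, forall x, r x < n & forall j, j < n -> exists x, r x == j].

Lemma numbers_map (A B : finType) n (r : A -> nat) (r' : B -> nat) :
  numbers n r -> numbers n r' ->
  exists f : A -> B, bijective f /\ forall x, r' (f x) = r x.
Proof.
move=> [inj lt sur] [inj' lt' sur'].
pose f x := xchoose (sur' _ (lt x)); pose g y := xchoose (sur _ (lt' y)).
have fE x : r' (f x) = r x by exact/eqP/(xchooseP (sur' _ (lt x))).
have gE y : r (g y) = r' y by exact/eqP/(xchooseP (sur _ (lt' y))).
exists f; split=> //; exists g => x; first by apply: inj; rewrite gE fE.
by apply: inj'; rewrite fE gE.
Qed.

Lemma numbers_ord n : numbers n (@nat_of_ord n).
Proof.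
by split=> [|i|j lj]; [exact: val_inj|exact: ltn_ord|exists (Ordinal lj)].
Qed.

Lemma numbers_sum (A B : finType) m n (r : A -> nat) (s : B -> nat) :
  numbers m r -> numbers n s ->
  numbers (m + n) (fun x => match x with inl u => r u | inr v => m + s v end).
Proof.
move=> [ri rl rs] [si sl ss]; split.
- move=> [u|u] [v|v].
  + by move=> /ri ->.
  + by have := rl u; lia.
  + by have := rl v; lia.
  + by move=> /addnI/si ->.
- by move=> [u|u]; [have := rl u|have := sl u]; lia.
- move=> j lj; have [jm|mj] := ltnP j m.
    by have [x xE] := rs _ jm; exists (inl x).
  have [|x /eqP xE] := ss (j - m); first by lia.
  by exists (inr x); apply/eqP; lia.
Qed.

Lemma numbers_bool : numbers 2 nat_of_bool.
Proof.
split; first by move=> [] [].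
  by move=> [].
by move=> [|[|j]] // _; [exists false|exists true].
Qed.

Definition ecode a (V A : finType) (rV : V -> nat) (rA : A -> nat)
    (x : V * bool + A) : nat :=
  match x with inl (v, s) => a + (rV v).*2 + s | inr i => rA i end.

Lemma numbers_ecode a n (V A : finType) (rV : V -> nat) (rA : A -> nat) :
  numbers n rV -> numbers a rA -> numbers (a + n.*2) (ecode a rV rA).
Proof.
move=> [vi vl vs] [ai al as_]; split.
- move=> [[v s]|i] [[w t]|j] /=.
  + by move=> E; have [/vi -> ->] : rV v = rV w /\ s = t by case: s t E =>
    [] []; lia.
  + by have := al j; lia.
  + by have := al i; lia.
  + by move=> /ai ->.
- move=> [[v s]|i] /=; last by have := al i; lia.
  by have := vl v; case: s; lia.
- move=> j lj; have [ja|aj] := ltnP j a.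
    by have [x xE] := as_ _ ja; exists (inr x).
  have [|v /eqP vE] := vs (j - a)./2; first by lia.
  exists (inl (v, odd (j - a))) => /=; rewrite vE -addnA.
  by rewrite [_.*2 + _]addnC odd_double_half subnKC.
Qed.

(* The boundary points come first, in [0, a), then the ends of the strands
   [false] and [true] of each vertex. *)
Record data := Data { signs : seq bool; table : seq nat }.

Definition encodes a (I O : finType) (rI : I -> nat) (rO : O -> nat) (D : data)
    (t : otangle I O) : Prop :=
  exists rV : vert t -> nat,
    [/\ numbers (size (signs D)) rV,
        forall v, sgn v = nth true (signs D) (rV v)
      & forall x, ecode a rV rO (conn x) = nth 0 (table D) (ecode a rV rI x)].

Definition valid a (D : data) : bool :=
  perm_eq (table D) (iota 0 (a + (size (signs D)).*2)).

Section Coding.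
Variables (a : nat) (I O : finType) (rI : I -> nat) (rO : O -> nat).
Hypotheses (nI : numbers a rI) (nO : numbers a rO).

(** A permutation of the codes has its inverse given by [index]; transported through the numberings
    of the ends, the two become [conn] and its inverse. The vertices are the ordinals themselves. *)
Lemma realize D : valid a D -> exists t : otangle I O, encodes a rI rO D t.
Proof.
move=> vD; set n := size (signs D) in vD.
have [si sl ss] := numbers_ecode (numbers_ord n) nI.
have [ti tl ts] := numbers_ecode (numbers_ord n) nO.
have sz : size (table D) = a + n.*2 by rewrite (perm_size vD) size_iota.
have un : uniq (table D) by rewrite (perm_uniq vD) iota_uniq.
have mem c : (c \in table D) = (c < a + n.*2).
  by rewrite (perm_mem vD) mem_iota.
have tP x : exists y, ecode a (@nat_of_ord n) rO y
                 == nth 0 (table D) (ecode a (@nat_of_ord n) rI x).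
  by apply: ts; rewrite -mem mem_nth // sz.
have sP y : exists x, ecode a (@nat_of_ord n) rI x
                 == index (ecode a (@nat_of_ord n) rO y) (table D).
  by apply: ss; rewrite -sz index_mem mem.
pose c x := xchoose (tP x).
have cE x : ecode a (@nat_of_ord n) rO (c x)
              = nth 0 (table D) (ecode a (@nat_of_ord n) rI x).
  exact/eqP/(xchooseP (tP x)).
have cb : bijective c.
  exists (fun y => xchoose (sP y)) => [x|y].
    apply: si; rewrite (eqP (xchooseP (sP _))) cE index_uniq // sz; exact: sl.
  by apply: ti; rewrite cE (eqP (xchooseP (sP y))) nth_index // mem.
exists (OTangle (fun v : 'I_n => nth true (signs D) v) cb), (@nat_of_ord n).
by split=> //; exact: numbers_ord.
Qed.

(** The two numberings of vertices match up to a bijection, and codes of targets are injective, so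
    agreement with one table suffices. Every move is verified through this comparison. *)
Lemma presents_encode D t (V : finType) (r : V -> nat) sg c :
  encodes a rI rO D t -> numbers (size (signs D)) r ->
  (forall v, sg v = nth true (signs D) (r v)) ->
  (forall x, omap (ecode a r rO) (c x) = Some (nth 0 (table D) (ecode a r rI
    x))) ->
  presents sg c t.
Proof.
move=> [rV [nV sE cE]] nr sgE cxE.
have [f [fb fE]] := numbers_map nr nV.
have renE (A : finType) (rA : A -> nat) (x : V * bool + A) :
    ecode a rV rA (ren f x) = ecode a r rA x.
  by case: x => [[v s]|//]; rewrite /= fE.
exists f; split=> // [v|x]; first by rewrite sE fE sgE.
move: (cxE x); case: (c x) => //= y [yE]; congr Some.
have [+ _ _] := numbers_ecode nV nO; apply.
by rewrite cE !renE.
Qed.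

Lemma encodes_iso D t t' :
  encodes a rI rO D t -> encodes a rI rO D t' -> iso t t'.
Proof.
move=> [rV [nV sE cE]] et'; apply: (presents_encode et' nV) => // x.
by rewrite /= cE.
Qed.

(** Action on codes of a permutation [p] of the vertices, with the boundary fixed: [(c - a)./2] is
    the vertex and [odd (c - a)] the strand. *)
Definition recode (p : seq nat) (c : nat) : nat :=
  if c < a then c else a + (nth 0 p (c - a)./2).*2 + odd (c - a).

Definition renumbers (p : seq nat) (D D' : data) : bool :=
  let n := size (signs D) in
  [&& perm_eq p (iota 0 n), size (signs D') == n,
      all (fun v => nth true (signs D') (nth 0 p v) == nth true (signs D) v)
          (iota 0 n)
    & all (fun c => nth 0 (table D') (recode p c)
                      == recode p (nth 0 (table D) c)) (iota 0 (a + n.*2))].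

Lemma encodes_renumber p D D' t :
  renumbers p D D' -> encodes a rI rO D t -> encodes a rI rO D' t.
Proof.
move=> /and4P[pp /eqP sz /allP sgE /allP tE] [rV [nV sE cE]].
have [vi vl vs] := nV.
set n := size (signs D) in pp sz sgE tE nV vl vs.
have szp : size p = n by rewrite (perm_size pp) size_iota.
have up : uniq p by rewrite (perm_uniq pp) iota_uniq.
have mem c : (c \in p) = (c < n) by rewrite (perm_mem pp) mem_iota.
have recE (A : finType) (rA : A -> nat) : numbers a rA -> forall x,
    ecode a (fun v => nth 0 p (rV v)) rA x = recode p (ecode a rV rA x).
  move=> [_ al _] [[v s]|i] /=; rewrite /recode; last by rewrite al.
  have -> : (a + (rV v).*2 + s < a) = false by lia.
  have -> : a + (rV v).*2 + s - a = s + (rV v).*2 by lia.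
  by rewrite half_bit_double oddD odd_double addbF oddb.
exists (fun v => nth 0 p (rV v)); split.
- split=> [v w /eqP|v|j].
  + by rewrite nth_uniq ?szp ?vl // => /eqP/vi.
  + by rewrite sz -mem mem_nth // szp.
  + rewrite sz -mem => jp; have [|v /eqP vE] := vs (index j p).
      by rewrite -szp index_mem.
    by exists v; rewrite vE nth_index.
- by move=> v; rewrite (eqP (sgE _ _)) // mem_iota vl.
- move=> x; rewrite !recE // cE (eqP (tE _ _)) // mem_iota.
  by have [_ + _] := numbers_ecode nV nI; apply.
Qed.

End Coding.

Lemma numbers_comp (A B : finType) n (f : B -> A) (r : A -> nat) :
  bijective f -> numbers n r -> numbers n (r \o f).
Proof.
move=> [g fK gK] [ri rl rs]; split=> [||j /rs[x /eqP xE]].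
- by apply: inj_comp => //; exact: can_inj fK.
- by move=> x; exact: rl.
- by exists (g x); rewrite /= gK xE.
Qed.

Definition sum_swap (A B : Type) (x : A + B) : B + A :=
  match x with inl u => inr u | inr v => inl v end.

Lemma sum_swap_bij (A B : Type) : bijective (@sum_swap A B).
Proof. by exists (@sum_swap B A); case. Qed.

Definition arcless (I O : finType) (t : otangle I O) : Prop :=
  forall i, exists w : vert t * bool, conn (inr i : vert t * bool + I) = inl w.

(** * Composition of o-tangles on tables *)

Section Plug.
Variables (a a0 : nat) (C U : data).
Let n := size (signs C).
Let inner y := y - a0 + (a + n.*2).
Let enterD y :=
  if y < a then y
  else if y < a + a0 then inner (nth 0 (table U) (y - a))
  else y - a0.

(** The composite lists its boundary, then the ends of the outer crossings, then those of the inner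
    ones. In the outer table the boundary of the hole occupies [[a, a + a0)], whence the shifts by
    [a0]. *)
Definition plug_entry c :=
  if c < a then enterD (nth 0 (table C) c)
  else if c < a + n.*2 then enterD (nth 0 (table C) (c + a0))
  else let y := nth 0 (table U) (c - (a + n.*2) + a0) in
       if y < a0 then enterD (nth 0 (table C) (a + y)) else inner y.

Definition plug_data : data :=
  Data (signs C ++ signs U)
       (mkseq plug_entry (a + (n + size (signs U)).*2)).

Variables (I0 O0 I O : finType).
Variables (rI0 : I0 -> nat) (rO0 : O0 -> nat) (rI : I -> nat) (rO : O -> nat).
Hypotheses (nI0 : numbers a0 rI0) (nO0 : numbers a0 rO0).
Hypotheses (nI : numbers a rI) (nO : numbers a rO).

(** The hole is numbered after the remaining boundary, although it is the left summand, so that the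
    boundary points of the composite keep their codes. *)
Definition hole (A B : Type) (r : A -> nat) (s : B -> nat) (x : A + B) : nat :=
  match x with inl u => a + r u | inr v => s v end.

Lemma numbers_hole (A B : finType) (r : A -> nat) (s : B -> nat) :
  numbers a0 r -> numbers a s -> numbers (a + a0) (hole r s).
Proof.
move=> nr ns; have [i l s'] := numbers_comp (@sum_swap_bij A B) (numbers_sum ns
  nr).
split=> [x y E|x|j lj]; first by apply: i; move: E; case: x y => ? [].
  by have := l x; case: x.
by have [x xE] := s' _ lj; exists x; case: x xE.
Qed.

(** Since [u] is arcless, every edge entering the hole ends at an inner crossing: [enter] is never
    [None], and the truncated subtraction in [inner] is exact. *)
Lemma plugged_encode (X : otangle (O0 + I)%type (I0 + O)%type)
    (u : otangle I0 O0) (t : otangle I O) :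
  arcless u ->
  encodes (a + a0) (hole rO0 rI) (hole rI0 rO) C X ->
  encodes a0 rI0 rO0 U u -> encodes a rI rO plug_data t -> plugged X u t.
Proof.
move=> arc [rX [nX sX cX]] [rU [nU sU cU]] et.
pose r (v : vert X + vert u) := match v with inl w => rX w | inr w =>
  n + rU w end.
have [_ lI0 _] := nI0; have [_ lO0 _] := nO0.
have [_ lI _] := nI; have [_ lO _] := nO; have [_ lX _] := nX.
have [_ lU _] := nU.
have enterE y : omap (ecode a r rO) (@enter _ _ _ _ X u y)
    = Some (enterD (ecode (a + a0) rX (hole rI0 rO) y)).
  case: y => [[w s]|[i|o]] /=; rewrite /enterD.
  - rewrite !ifN; [by congr Some; lia|by lia|by lia].
  - have := cU (inr i); have [[w s] ->] /= := arc i; have := lI0 i => li.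
    rewrite ifN ?ltn_add2l ?li; last by lia.
    have -> : a + rI0 i - a = rI0 i by lia.
    by move=> <-; congr Some; rewrite /inner; lia.
  - by rewrite lO.
apply: (presents_encode (r := r) nO et) => [|v|x].
- by rewrite /= size_cat; exact: numbers_sum nX nU.
- rewrite /= nth_cat; case: v => w /=; first by rewrite lX sX.
  by rewrite -/n ltnNge leq_addr /= addKn sU.
have [_ rl _] := numbers_sum nX nU.
have rlt (v : vert X + vert u) : r v < n + size (signs U) by exact: rl.
rewrite /= nth_mkseq; last first.
  by case: x => [[v s]|i] /=; [have := rlt v; case: s; lia|have := lI i; lia].
case: x => [[[v|v] s]|i] /=; rewrite /plug_entry.
- rewrite enterE cX /= ifN; last by lia.
  rewrite ifT; last by have := lX v; rewrite -/n; case: s; lia.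
  by congr (Some (enterD (nth _ _ _))); lia.
- rewrite ifN; last by lia.
  rewrite ifN; last by lia.
  have -> : a + (n + rU v).*2 + s - (a + n.*2) + a0 = a0 + (rU v).*2 + s by lia.
  have := cU (inl (v, s)); rewrite /= => <-.
  case: (conn (inl (v, s))) => [[w p]|o] /=.
    by rewrite ifN; [congr Some; rewrite /inner; lia|lia].
  by rewrite lO0 enterE cX.
- by rewrite lI enterE cX.
Qed.

End Plug.

(** * Sliding moves on tables *)

Section SlideData.
Variables (a : nat) (k : ps_type) (x1 x2 : nat) (fst1 : bool) (D : data).
Let n := size (signs D).
Let p := ps_p k.
Let q := ps_q k.

Definition pillow_code (f : 'I_4) : nat := a + (n + ~~ odd f).*2 + (f < 2).

(** The pillow has the last four codes, the negative crossing first: beyond [a + n.*2], an offset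
    above 1 means the positive crossing, and the parity of the offset is the strand. *)
Definition slide_entry c :=
  if c < a + n.*2 then
    if (c == x1) && ~~ ((x1 == x2) && ~~ fst1) then pillow_code q
    else if c == x2 then pillow_code p
    else nth 0 (table D) c
  else
    let f := out_face (1 < c - (a + n.*2)) (odd (c - (a + n.*2))) in
    if f == q then
      if (x1 == x2) && fst1 then pillow_code p else nth 0 (table D) x1
    else if f == p then
      if (x1 == x2) && ~~ fst1 then pillow_code q else nth 0 (table D) x2
    else pillow_code f.

Definition slide_data : data :=
  Data (signs D ++ [:: false; true]) (mkseq slide_entry (a + (n + 2).*2)).

Definition at_face (c v : nat) (f : 'I_4) : bool :=
  let s := nth true (signs D) v in
  [|| (c == a + v.*2) && (out_face s false == f),
      (c == a + v.*2 + 1) && (out_face s true == f),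
      (nth 0 (table D) c == a + v.*2) && (in_face s false == f)
    | (nth 0 (table D) c == a + v.*2 + 1) && (in_face s true == f)].

(* A walk around an edge of T: each step passes from a place to another through
   the tetrahedron [v] by its faces [f] and [f']. *)
Fixpoint walk (y : nat * 'I_3) (w : seq (nat * 'I_4 * 'I_4 * (nat * 'I_3)))
    (z : nat * 'I_3) : bool :=
  match w with
  | [::] => y == z
  | (v, f, f', y') :: w' =>
      [&& v < n, y'.1 < a + n.*2, at_face y.1 v f, at_face y'.1 v f',
          lift f y.2 == f', lift f' y'.2 == f & walk y' w' z]
  end.

Variables (I O : finType) (rI : I -> nat) (rO : O -> nat).
Hypotheses (nI : numbers a rI) (nO : numbers a rO).

Lemma walk_same_edge (t : otangle I O) (rV : vert t -> nat) (y z : place t) w :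
  numbers n rV -> (forall v, sgn v = nth true (signs D) (rV v)) ->
  (forall x, ecode a rV rO (conn x) = nth 0 (table D) (ecode a rV rI x)) ->
  walk (ecode a rV rI y.1, y.2) w (ecode a rV rI z.1, z.2) -> same_edge y z.
Proof.
move=> nV sV cV; have [sinj sl ss] := numbers_ecode nV nI.
have [tinj _ _] := numbers_ecode nV nO.
have [_ vl vs] := nV.
have faceP x v f : at_face (ecode a rV rI x) (rV v) f -> is_face x v f.
  rewrite /at_face -sV -cV /is_face.
  have S (s : bool) : (ecode a rV rI x == a + (rV v).*2 + s) = (x == inl (v,
    s)).
    by rewrite -(inj_eq sinj).
  have T (s : bool) : (ecode a rV rO (conn x) == a + (rV v).*2 + s)
             = (conn x == inl (v, s)).
    by rewrite -(inj_eq tinj).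
  have := S false; rewrite addn0 => ->; have := S true => /= ->.
  have := T false; rewrite addn0 => ->; have := T true => /= ->.
  by case/or4P => /andP[/eqP-> ->]; rewrite eqxx ?orbT.
elim: w y => [|[[[v f] f'] [c k']] w IH] y /=.
  case: y z => [y1 y2] [z1 z2] /= /eqP[/sinj -> ->].
  exact: connect0.
case/andP=> lv /andP[lc /and5P[F F' E E' W]].
have [w0 /eqP wE] := vs _ lv; have [x /eqP xE] := ss _ lc.
have := IH (x, k') _; rewrite xE => /(_ W); apply: connect_trans.
apply: connect1; apply/existsP; exists w0; apply/existsP; exists f.
apply/existsP; exists f'; move: F F'; rewrite -wE -xE.
by move=> /faceP -> /faceP ->; rewrite E E'.
Qed.

Lemma ps_step_encode (t t' : otangle I O) (k1 k2 : 'I_3) w :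
  lift q k1 = p -> lift p k2 = q -> x1 < a + n.*2 -> x2 < a + n.*2 ->
  walk (x1, k1) w (x2, k2) ->
  encodes a rI rO D t -> encodes a rI rO slide_data t' -> ps_step k t t'.
Proof.
move=> K1 K2 l1 l2 W [rV [nV sV cV]] et'.
have [sinj sl ss] := numbers_ecode nV nI.
have [y1 /eqP E1] := ss _ l1; have [y2 /eqP E2] := ss _ l2.
exists y1, y2, k1, k2, fst1; split=> //.
  by apply: (@walk_same_edge _ rV _ _ w) => //=; rewrite E1 E2.
have [_ lI _] := nI; have [_ vl _] := nV.
pose r (v : vert t + bool) := match v with inl w => rV w | inr w => n + w end.
have nr : numbers (n + 2) r := numbers_sum nV numbers_bool.
have renE y : ecode a r rO (ren inl y) = ecode a rV rO y.
  by case: y => [[v s]|].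
have pilE f : ecode a r rO (@pillow_in _ _ t f) = pillow_code f by [].
have ee : (x1 == x2) = (y1 == y2) by rewrite -(inj_eq sinj) E1 E2.
have startE y : ecode a r rO (slide_start k y1 y2 fst1 y)
    = slide_entry (ecode a rV rI y).
  rewrite /slide_start /slide_entry sl ee.
  have -> : (ecode a rV rI y == x1) = (y == y1) by rewrite -E1 (inj_eq sinj).
  have -> : (ecode a rV rI y == x2) = (y == y2) by rewrite -E2 (inj_eq sinj).
  by case: ifP => _; [|case: ifP => _]; rewrite ?pilE ?renE ?cV.
apply: (presents_encode (r := r) nO et') => [|v|x].
- by rewrite /= size_cat.
- rewrite /= nth_cat; case: v => b /=; first by rewrite vl sV.
  by rewrite -/n ltnNge leq_addr /= addKn; case: b.
have [_ rl _] := numbers_ecode nr nI.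
rewrite /= nth_mkseq; last exact: rl.
case: x => [[[v|b] s]|i]; [by rewrite [LHS]/= startE|
  |by rewrite [LHS]/= startE].
rewrite [in RHS]/= /slide_entry ifN; last by lia.
have -> : a + (n + b).*2 + s - (a + n.*2) = s + b.*2 by lia.
have -> : 1 < s + b.*2 = b by case: b; case: s.
rewrite oddD odd_double addbF oddb /slide_conn -/p -/q -ee.
by case: ifP => _; [case: ifP => _|case: ifP => _; [case: ifP => _|]];
  rewrite /= ?pilE ?renE ?cV ?E1 ?E2.
Qed.

End SlideData.

(** * The two sides of an MP move *)

Definition mp_types : seq mp_type :=
  let o i := fun li : i < 5 => Ordinal li in
  [:: @MpType (o 0 isT) (o 2 isT) (o 1 isT) (o 3 isT) (o 4 isT) isT;
      @MpType (o 0 isT) (o 3 isT) (o 1 isT) (o 2 isT) (o 4 isT) isT;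
      @MpType (o 0 isT) (o 4 isT) (o 1 isT) (o 2 isT) (o 3 isT) isT;
      @MpType (o 1 isT) (o 2 isT) (o 0 isT) (o 3 isT) (o 4 isT) isT;
      @MpType (o 1 isT) (o 3 isT) (o 0 isT) (o 2 isT) (o 4 isT) isT;
      @MpType (o 1 isT) (o 4 isT) (o 0 isT) (o 2 isT) (o 3 isT) isT;
      @MpType (o 2 isT) (o 0 isT) (o 1 isT) (o 3 isT) (o 4 isT) isT;
      @MpType (o 2 isT) (o 1 isT) (o 0 isT) (o 3 isT) (o 4 isT) isT;
      @MpType (o 2 isT) (o 3 isT) (o 0 isT) (o 1 isT) (o 4 isT) isT;
      @MpType (o 2 isT) (o 4 isT) (o 0 isT) (o 1 isT) (o 3 isT) isT;
      @MpType (o 3 isT) (o 0 isT) (o 1 isT) (o 2 isT) (o 4 isT) isT;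
      @MpType (o 3 isT) (o 1 isT) (o 0 isT) (o 2 isT) (o 4 isT) isT;
      @MpType (o 3 isT) (o 2 isT) (o 0 isT) (o 1 isT) (o 4 isT) isT;
      @MpType (o 4 isT) (o 0 isT) (o 1 isT) (o 2 isT) (o 3 isT) isT;
      @MpType (o 4 isT) (o 1 isT) (o 0 isT) (o 2 isT) (o 3 isT) isT;
      @MpType (o 4 isT) (o 2 isT) (o 0 isT) (o 1 isT) (o 3 isT) isT].

(** Among all choices of five ranks, [mp_ok] leaves exactly the 16 listed; being boolean, it has
    only one proof. Statements about all types thus reduce to one computation. *)
Lemma mp_typesP (P : pred mp_type) : all P mp_types -> forall m, P m.
Proof.
rewrite /mp_types; cbn [all]; do 16![case/andP => ?]; move=> _.
case=> a b c d e.
elim/ord5_ind: a; elim/ord5_ind: b;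
  try (by move=> ok; exfalso; vm_compute in ok);
elim/ord5_ind: c; try (by move=> ok; exfalso; vm_compute in ok);
elim/ord5_ind: d; try (by move=> ok; exfalso; vm_compute in ok);
elim/ord5_ind: e; try (by move=> ok; exfalso; vm_compute in ok);
by move=> ok; rewrite (bool_irrelevance ok isT).
Qed.

Section PieceData.
Variable m : mp_type.
Implicit Types (two : bool) (x y : 'I_5 * 'I_5).

(* The triangles are named by pairs of omitted vertices. *)
Definition tri x : {set 'I_5} := ~: [set x.1; x.2].
(** The sorted pair of omitted vertices, read in base 5: a number on which tables can be evaluated,
    unlike the finite set [tri x]. *)
Definition tri_code x : nat :=
  if x.1 < x.2 then 5 * x.1 + x.2 else 5 * x.2 + x.1.

Definition in_ends two := [seq (i, opp_in m i s) |
  i <- tets m two, s <- [:: false; true]].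
Definition out_ends two := [seq (i, opp_out m i s) |
  i <- tets m two, s <- [:: false; true]].
Definition outer_ins := [seq x <- in_ends true | x.2 \in tets m false].
Definition outer_outs := [seq x <- out_ends true | x.2 \in tets m false].

(** Sources and targets are listed in the order of [ecode], boundary first; an edge is found by
    searching for its triangle among the targets. *)
Definition piece_data two : data :=
  Data (map (tet_sgn m) (tets m two))
       [seq index (tri_code x) (map tri_code (outer_outs ++ in_ends two))
         | x <- outer_ins ++ out_ends two].

Definition rank_in (f : mp_in m) : nat := index (val f) (map tri outer_ins).
Definition rank_out (f : mp_out m) : nat := index (val f) (map tri outer_outs).

Definition piece_ok : bool :=
  [&& size outer_ins == 3, size outer_outs == 3,
      uniq (map tri_code outer_ins)
    & all (fun two => uniq (tets m two)
                      && uniq (map tri_code (outer_outs ++ in_ends two)))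
          [:: true; false]].

End PieceData.

Lemma piece_okT m : piece_ok m.
Proof. by apply: mp_typesP m; vm_compute. Qed.

Lemma eq_tri x y : x.1 != x.2 -> y.1 != y.2 ->
  (tri x == tri y) = (tri_code x == tri_code y).
Proof.
case: x y => [i j] [k l] /= ij kl; apply/eqP/eqP; rewrite /tri_code /=.
  case/(setC2_inj ij) => -[-> ->] //.
  by move: kl; rewrite -(inj_eq val_inj) /=; do 2!case: ifP; lia.
move: ij kl; rewrite -!(inj_eq val_inj) /= => ij kl E; rewrite /tri /=;
  congr (~: _).
have := ltn_ord i; have := ltn_ord j; have := ltn_ord k; have := ltn_ord l.
move=> *.
have [[/ord_inj -> /ord_inj ->]|[/ord_inj -> /ord_inj ->]] :
  (i = k :> nat /\ j = l :> nat) \/ (i = l :> nat /\ j = k :> nat).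
  by move: E; do 2!case: ifP; lia.
  by [].
by rewrite setUC.
Qed.

Lemma index_tri x s : x.1 != x.2 -> all (fun y => y.1 != y.2) s ->
  index (tri x) (map tri s) = index (tri_code x) (map tri_code s).
Proof.
move=> xx; elim: s => //= y s IH /andP[yy ss].
by rewrite eq_tri // IH.
Qed.

Lemma uniq_tri s : all (fun y => y.1 != y.2) s ->
  uniq (map tri_code s) -> uniq (map tri s).
Proof.
elim: s => //= y s IH /andP[yy ss] /andP[n u]; rewrite IH // andbT.
by rewrite -index_mem index_tri // size_map -(size_map tri_code) index_mem.
Qed.

Lemma nth_strands (A B : eqType) (f : A -> bool -> B) (x0 : A * B) (T : seq A)
    i (s : bool) : i \in T ->
  nth x0 [seq (i, f i s) | i <- T, s <- [:: false; true]] ((index i T).*2 + s)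
    = (i, f i s).
Proof.
elim: T => //= j T IH; rewrite inE [j == i]eq_sym.
case: eqP => [->|_] /= iT; first by case: (s).
by rewrite -IH.
Qed.

Lemma size_strands (A B : Type) (f : A -> bool -> B) (T : seq A) :
  size [seq (i, f i s) | i <- T, s <- [:: false; true]] = (size T).*2.
Proof. by rewrite size_allpairs muln2. Qed.

Section Piece.
Variable m : mp_type.
Let d : 'I_5 * 'I_5 := (ord0, ord0).

Lemma in_ends_neq two : all (fun y => y.1 != y.2) (in_ends m two).
Proof. by apply/allP => _ /allpairsP[[i s] [_ _ ->]]; exact: opp_in_neq. Qed.
Lemma out_ends_neq two : all (fun y => y.1 != y.2) (out_ends m two).
Proof. by apply/allP => _ /allpairsP[[i s] [_ _ ->]]; exact: opp_out_neq. Qed.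
Lemma outer_ins_neq : all (fun y => y.1 != y.2) (outer_ins m).
Proof. by apply/allP => y; rewrite mem_filter =>
  /andP[_ /(allP (in_ends_neq _))]. Qed.
Lemma outer_outs_neq : all (fun y => y.1 != y.2) (outer_outs m).
Proof. by apply/allP => y; rewrite mem_filter =>
  /andP[_ /(allP (out_ends_neq _))]. Qed.

Lemma mp_in_mem (f : mp_in m) : val f \in map tri (outer_ins m).
Proof.
have /exists_inP[i iT /existsP[s /andP[ji /eqP ->]]] := valP f.
apply/mapP; exists (i, opp_in m i s) => //; rewrite mem_filter ji.
by apply/allpairsP; exists (i, s); split=> //; case: s {ji}.
Qed.

Lemma mp_out_mem (f : mp_out m) : val f \in map tri (outer_outs m).
Proof.
have /exists_inP[i iT /existsP[s /andP[ji /eqP ->]]] := valP f.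
apply/mapP; exists (i, opp_out m i s) => //; rewrite mem_filter ji.
by apply/allpairsP; exists (i, s); split=> //; case: s {ji}.
Qed.

Lemma rank_in_numbers : numbers 3 (@rank_in m).
Proof.
have /and4P[/eqP sz _ u _] := piece_okT m.
have ut := uniq_tri outer_ins_neq u.
split=> [f g|f|j lj].
- move=> E; apply: val_inj.
  by rewrite -(nth_index set0 (mp_in_mem f)) -(nth_index set0 (mp_in_mem g))
    [index _ _]E.
- by rewrite -sz -(size_map tri) index_mem mp_in_mem.
- have mj : nth d (outer_ins m) j \in outer_ins m by rewrite mem_nth ?sz.
  have fP : is_mp_in m (tri (nth d (outer_ins m) j)).
    move: mj; rewrite mem_filter => /andP[oj /allpairsP[[i s] [iT _ E]]].
    move: oj; rewrite E /= => oj.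
    by apply/exists_inP; exists i => //; apply/existsP; exists s; rewrite oj /=.
  exists (exist (fun f => is_true (is_mp_in m f)) _ fP); rewrite /rank_in /=.
  by rewrite -(nth_map d set0) ?sz // index_uniq // size_map sz.
Qed.

Lemma rank_out_numbers : numbers 3 (@rank_out m).
Proof.
have /and4P[_ /eqP sz _ /and3P[/andP[_ uo] _ _]] := piece_okT m.
have u : uniq (map tri_code (outer_outs m)).
  by move: uo; rewrite map_cat cat_uniq => /andP[].
have ut := uniq_tri outer_outs_neq u.
split=> [f g|f|j lj].
- move=> E; apply: val_inj.
  by rewrite -(nth_index set0 (mp_out_mem f)) -(nth_index set0 (mp_out_mem g))
    [index _ _]E.
- by rewrite -sz -(size_map tri) index_mem mp_out_mem.
- have mj : nth d (outer_outs m) j \in outer_outs m by rewrite mem_nth ?sz.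
  have fP : is_mp_out m (tri (nth d (outer_outs m) j)).
    move: mj; rewrite mem_filter => /andP[oj /allpairsP[[i s] [iT _ E]]].
    move: oj; rewrite E /= => oj.
    by apply/exists_inP; exists i => //; apply/existsP; exists s; rewrite oj /=.
  exists (exist (fun f => is_true (is_mp_out m f)) _ fP); rewrite /rank_out /=.
  by rewrite -(nth_map d set0) ?sz // index_uniq // size_map sz.
Qed.

(** [piece_conn] is determined by preservation of the triangle ([piece_connE]), and the triangles at
    the targets are distinct, so [index] recovers it and the choice inside [piece_conn] is never
    evaluated. *)
Lemma encodes_piece two :
  encodes 3 (@rank_in m) (@rank_out m) (piece_data m two) (piece m two).
Proof.
have /and4P[/eqP szi /eqP szo ui /and3P[ok1 ok2 _]] := piece_okT m.
have /andP[ut ue] : uniq (tets m two)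
    && uniq (map tri_code (outer_outs m ++ in_ends m two)) by case: two.
have neq : all (fun y => y.1 != y.2) (outer_outs m ++ in_ends m two).
  by rewrite all_cat outer_outs_neq in_ends_neq.
pose rV (v : tet m two) := index (val v) (tets m two).
have lV v : rV v < size (tets m two) by rewrite index_mem; exact: valP v.
have numV : numbers (size (tets m two)) rV.
  split=> // [v w E|j lj].
    apply: val_inj; rewrite -(nth_index ord0 (valP v)) -(nth_index ord0 (valP
      w)).
    by rewrite [index _ _]E.
  have jP : nth ord0 (tets m two) j \in tets m two by exact: mem_nth.
  exists (exist (fun i => is_true (i \in tets m two)) _ jP).
  by rewrite /rV /= index_uniq.
exists rV; split=> [|v|x].
- by rewrite /= size_map.
- by rewrite /= (nth_map ord0) // nth_index //; exact: valP.
pose srcs := outer_ins m ++ out_ends m two.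
have lx : ecode 3 rV (@rank_in m) x < size srcs.
  have [_ + _] := numbers_ecode numV rank_in_numbers.
  by rewrite size_cat szi size_strands; apply.
(* The list [srcs] is in the order of the codes of sources; [tgtE] is the analogue for targets. *)
have srcE : tri (nth d srcs (ecode 3 rV (@rank_in m) x)) = src_tri x.
  rewrite nth_cat szi; case: x {lx} => [[v s]|f] /=.
    rewrite -addnA addKn nth_strands //; exact: valP v.
  have [_ + _] := rank_in_numbers => ->.
  rewrite -(nth_map d set0) ?nth_index ?mp_in_mem //.
  by have [_ + _] := rank_in_numbers; rewrite szi; apply.
have tgtE y : ecode 3 rV (@rank_out m) y
    = index (tgt_tri y) (map tri (outer_outs m ++ in_ends m two)).
  have un := uniq_tri neq ue.
  set k := ecode _ _ _ _.
  have lk : k < size (outer_outs m ++ in_ends m two).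
    have [_ + _] := numbers_ecode numV rank_out_numbers.
    by rewrite size_cat szo size_strands; apply.
  suff <- : tri (nth d (outer_outs m ++ in_ends m two) k) = tgt_tri y.
    by rewrite -(nth_map d set0) // index_uniq // size_map.
  rewrite nth_cat szo /k; case: y {k lk} => [[v s]|f] /=.
    rewrite -addnA addKn nth_strands //; exact: valP v.
  have [_ + _] := rank_out_numbers => ->.
  rewrite -(nth_map d set0) ?nth_index ?mp_out_mem //.
  by have [_ + _] := rank_out_numbers; rewrite szo; apply.
rewrite tgtE [table _]/= (nth_map d) // -index_tri //; last first.
  apply: (allP (a := fun y => y.1 != y.2)) (mem_nth d lx).
  by rewrite all_cat outer_ins_neq out_ends_neq.
by rewrite srcE /= piece_connE.
Qed.

End Piece.

(** * Derivations of the non-cyclic MP moves *)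

(** The positions of p in xyp and of q in xyq, forced by the [lift] equations of [ps_step]. *)
Definition ps_position (k : ps_type) : 'I_3 * 'I_3 :=
  let o i := fun li : i < 3 => Ordinal li in
  match k with
  | psI => (o 0 isT, o 1 isT)
  | psII => (o 1 isT, o 2 isT)
  | psIII => (o 0 isT, o 2 isT)
  | psIV => (o 1 isT, o 1 isT)
  end.

Lemma ps_positionP k :
  lift (ps_q k) (ps_position k).1 = ps_p k /\
  lift (ps_p k) (ps_position k).2 = ps_q k.
Proof. by case: k; split; apply: val_inj. Qed.

Record slide_witness := Slide {
  sl_k : ps_type; sl_x1 : nat; sl_x2 : nat; sl_fst1 : bool;
  sl_walk : seq (nat * 'I_4 * 'I_4 * (nat * 'I_3)) }.

Definition slid (w : slide_witness) (D : data) : data :=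
  slide_data 3 (sl_k w) (sl_x1 w) (sl_x2 w) (sl_fst1 w) D.

Definition slide_ok (w : slide_witness) (D : data) : bool :=
  let: Slide k x1 x2 _ p := w in
  let N := 3 + (size (signs D)).*2 in
  [&& ~~ ps_cyclic k, x1 < N, x2 < N
    & walk 3 D (x1, (ps_position k).1) p (x2, (ps_position k).2)].

Definition primary_data (two : bool) := piece_data primary_mp two.

(* The tangle is renumbered by the sequence before the move: [LMP] then carries
   the side replaced and the outer tangle, [LUnslide] the tangle reached. *)
Inductive link :=
  | LMP of bool & seq nat & data
  | LSlide of slide_witness
  | LUnslide of seq nat & slide_witness & data.

Definition link_target (l : link) (D : data) : data :=
  match l with
  | LMP two _ C => plug_data 3 3 C (primary_data (~~ two))
  | LSlide w => slid w D
  | LUnslide _ _ D' => D'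
  end.

(** The outer table has 6 boundary points on each side: 3 of the ambient o-tangle and 3 at the
    hole. *)
Definition link_ok (l : link) (D : data) : bool :=
  match l with
  | LMP two p C =>
      valid 6 C && renumbers 3 p D (plug_data 3 3 C (primary_data two))
  | LSlide w => slide_ok w D
  | LUnslide p w D' => renumbers 3 p D (slid w D') && slide_ok w D'
  end.

(** Validity of each intermediate table is what makes it the table of an actual o-tangle. *)
Fixpoint chain (D : data) (c : seq link) (p : seq nat) (D' : data) :=
  match c with
  | [::] => renumbers 3 p D D'
  | l :: c' =>
      let E := link_target l D in
      [&& valid 3 E, link_ok l D & chain E c' p D']
  end.

Definition primary_or_noncyclic_ps (mv : otmove) : bool :=
  is_primary_move mv || is_PS mv && ~~ cyclic mv.

Lemma piece_arcless m two : arcless (piece m two).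
Proof.
move=> f; have := piece_conn_arcless two f; rewrite [conn _]/=.
by case: (piece_conn _) => // w _; exists w.
Qed.

Section Sound.
Variables (I O : finType) (rI : I -> nat) (rO : O -> nat).
Hypotheses (nI : numbers 3 rI) (nO : numbers 3 rO).

(** A single realization of [C] is plugged with both sides, as [replaces] demands. *)
Lemma primary_step C (t t' : otangle I O) : valid 6 C ->
  encodes 3 rI rO (plug_data 3 3 C (primary_data true)) t ->
  encodes 3 rI rO (plug_data 3 3 C (primary_data false)) t' ->
  step (MP primary_mp) t t'.
Proof.
move=> vC et et'.
have ni := rank_in_numbers primary_mp; have no := rank_out_numbers primary_mp.
have [X eX] := realize (numbers_hole no nI) (numbers_hole ni nO) vC.
have es two := encodes_piece primary_mp two.
exists X; split.
  by apply: (plugged_encode ni no nI nO (@piece_arcless _ true) eX (es true)).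
by apply: (plugged_encode ni no nI nO (@piece_arcless _ false) eX (es false)).
Qed.

Lemma slide_step w D (t t' : otangle I O) : slide_ok w D ->
  encodes 3 rI rO D t -> encodes 3 rI rO (slid w D) t' ->
  step (PS (sl_k w)) t t' /\ ~~ ps_cyclic (sl_k w).
Proof.
case: w => k x1 x2 fst1 p /and4P[nc l1 l2 W] et et'.
split=> //; have [K1 K2] := ps_positionP k.
exact: (ps_step_encode nI nO K1 K2 l1 l2 W et et').
Qed.

Lemma link_step l D (t t' : otangle I O) : link_ok l D ->
  encodes 3 rI rO D t -> encodes 3 rI rO (link_target l D) t' ->
  exists r : otmove * bool, primary_or_noncyclic_ps r.1 /\
    (if r.2 then step r.1 t t' else step r.1 t' t).
Proof.
case: l => [two p C|w|p w D'] /=.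
- move=> /andP[vC ren] /(encodes_renumber nI nO ren) et et'.
  exists (MP primary_mp, two); split=> //.
  by case: two {ren} et et' => et et'; [exact: primary_step vC et et'|exact:
    primary_step vC et' et].
- move=> sl et et'; have [st nc] := slide_step sl et et'.
  by exists (PS (sl_k w), true); rewrite /primary_or_noncyclic_ps /= nc.
- move=> /andP[ren sl] /(encodes_renumber nI nO ren) et et'.
  have [st nc] := slide_step sl et' et.
  by exists (PS (sl_k w), false); rewrite /primary_or_noncyclic_ps /= nc.
Qed.

(** Each intermediate table is realized, consecutive realizations differ by one move, and the final
    renumbering is the isomorphism ending the sequence. *)
Lemma chain_sequence c p D D' (t t' : otangle I O) : chain D c p D' ->
  encodes 3 rI rO D t -> encodes 3 rI rO D' t' ->
  exists s, all (fun r : otmove * bool => primary_or_noncyclic_ps r.1) s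
            /\ sequence s t t'.
Proof.
elim: c D t => [|l c IH] D t /=.
  move=> ren /(encodes_renumber nI nO ren) et et'.
  by exists [::]; split=> //; apply: (encodes_iso nO et et').
move=> /and3P[vE lk ch] et et'; have [u eu] := realize nI nO vE.
have [s [sP su]] := IH _ _ ch eu et'.
have [[mv b] [ok st]] := link_step lk et eu.
by exists ((mv, b) :: s); rewrite /= ok sP; split=> //; exists u.
Qed.

End Sound.

Lemma chain_derived m c p : chain (piece_data m true) c p (piece_data m false)
  ->
  derived m primary_or_noncyclic_ps.
Proof.
move=> ch.
exact: (chain_sequence (rank_in_numbers m) (rank_out_numbers m) ch
          (encodes_piece m true) (encodes_piece m false)).
Qed.

Definition K0 : 'I_3 := @Ordinal 3 0 isT.
Definition K1 : 'I_3 := @Ordinal 3 1 isT.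
Definition K2 : 'I_3 := @Ordinal 3 2 isT.

(* Found by computer search. *)
Definition certificate (m : mp_type) : seq link * seq nat :=
  match nat_of_ord (va m), nat_of_ord (vb m) with
  | 0, 2 =>
    ([:: LSlide (Slide psI 5 3 true
         [:: (1, F2, F0, (6, K1)); (0, F1, F2, (3, K1))]);
     LSlide (Slide psI 10 4 true
         [:: (3, F1, F0, (3, K0)); (0, F2, F0, (4, K1))]);
     LMP true [:: 0; 1; 2; 5; 3; 4]
       (Data [:: false; false; false; false]
           [:: 6; 8; 9; 12; 13; 10; 5; 3; 4; 7; 2; 0; 11; 1]);
     LUnslide [:: 5; 0; 1; 2; 6; 3; 4]
       (Slide psII 0 4 true
         [:: (4, F0, F2, (9, K0)); (3, F3, F0, (4, K2))])
       (Data [:: false; false; false; true; true]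
           [:: 12; 3; 4; 9; 10; 2; 0; 6; 1; 11; 8; 5; 7]);
     LUnslide [:: 3; 0; 1; 4; 2]
       (Slide psII 1 2 true
         [:: (2, F2, F1, (8, K1)); (1, F3, F1, (2, K2))])
       (Data [:: false; false; true]
           [:: 8; 7; 6; 2; 0; 4; 1; 3; 5])],
     [:: 1; 0; 2])
  | 0, 3 =>
    ([:: LSlide (Slide psI 5 4 true
         [:: (1, F2, F0, (6, K1)); (0, F2, F1, (4, K1))]);
     LSlide (Slide psI 9 3 true
         [:: (3, F3, F0, (4, K2)); (0, F1, F3, (3, K1))]);
     LMP false [:: 3; 0; 1; 4; 2; 5]
       (Data [:: false; false; false]
           [:: 3; 6; 7; 11; 9; 10; 4; 5; 2; 1; 8; 0]);
     LUnslide [:: 3; 0; 1; 2; 4]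
       (Slide psII 1 2 true
         [:: (1, F3, F1, (7, K2)); (2, F3, F2, (2, K2))])
       (Data [:: false; false; true]
           [:: 8; 5; 7; 2; 1; 3; 0; 6; 4])],
     [:: 1; 2; 0])
  | 1, 3 =>
    ([:: LMP true [:: 0; 1]
       (Data [::]
           [:: 3; 4; 5; 0; 1; 2])],
     [:: 0; 1; 2])
  | 1, 4 =>
    ([:: LSlide (Slide psII 1 0 true
         [:: (1, F2, F1, (6, K1)); (0, F3, F1, (0, K2))]);
     LSlide (Slide psII 2 8 true
         [:: (1, F0, F2, (9, K0)); (3, F3, F0, (8, K2))]);
     LMP false [:: 0; 5; 1; 4; 2; 3]
       (Data [:: false; false; false]
           [:: 9; 8; 10; 6; 7; 2; 0; 1; 4; 11; 5; 3]);
     LUnslide [:: 3; 0; 1; 4; 2]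
       (Slide psI 8 6 true
         [:: (2, F1, F0, (5, K0)); (1, F2, F0, (6, K1))])
       (Data [:: false; false; true]
           [:: 4; 3; 5; 7; 6; 8; 1; 2; 0])],
     [:: 1; 0; 2])
  | 2, 0 =>
    ([:: LSlide (Slide psI 3 5 true
         [:: (0, F3, F0, (6, K2)); (1, F1, F3, (5, K1))]);
     LMP false [:: 2; 1; 0; 3]
       (Data [:: false]
           [:: 4; 5; 3; 7; 1; 6; 0; 2])],
     [:: 2; 0; 1])
  | 2, 4 =>
    ([:: LSlide (Slide psII 2 0 true
         [:: (1, F1, F2, (5, K1)); (0, F3, F1, (0, K2))]);
     LSlide (Slide psII 1 7 true
         [:: (1, F3, F1, (9, K2)); (3, F3, F2, (7, K2))]);
     LMP true [:: 0; 1; 2; 4; 3; 5]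
       (Data [:: false; false; false; false]
           [:: 11; 12; 10; 9; 7; 8; 0; 1; 6; 2; 13; 3; 4; 5]);
     LUnslide [:: 0; 5; 1; 2; 3; 4; 6]
       (Slide psI 11 9 true
         [:: (4, F3, F0, (10, K2)); (3, F1, F3, (9, K1))])
       (Data [:: false; false; false; true; true]
           [:: 6; 7; 5; 0; 1; 8; 10; 11; 9; 2; 12; 3; 4]);
     LUnslide [:: 3; 0; 1; 2; 4]
       (Slide psI 5 8 true
         [:: (1, F2, F0, (6, K1)); (2, F2, F1, (8, K1))])
       (Data [:: false; false; true]
           [:: 4; 5; 3; 6; 8; 0; 7; 2; 1])],
     [:: 1; 2; 0])
  | 3, 0 =>
    ([:: LSlide (Slide psI 4 6 true
         [:: (0, F1, F0, (5, K0)); (1, F2, F0, (6, K1))]);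
     LMP true [:: 3; 0; 1; 2]
       (Data [:: false; false]
           [:: 4; 6; 7; 8; 9; 0; 5; 3; 1; 2]);
     LUnslide [:: 3; 0; 4; 1; 2]
       (Slide psII 1 2 true
         [:: (2, F0, F2, (5, K0)); (1, F3, F0, (2, K2))])
       (Data [:: false; true; true]
           [:: 5; 8; 6; 1; 2; 7; 4; 0; 3])],
     [:: 0; 1; 2])
  | 3, 1 =>
    ([:: LSlide (Slide psII 0 1 true
         [:: (0, F3, F1, (5, K2)); (1, F2, F3, (1, K2))]);
     LSlide (Slide psII 7 2 true
         [:: (3, F2, F1, (10, K1)); (1, F3, F1, (2, K2))]);
     LSlide (Slide psII 8 12 true
         [:: (2, F0, F2, (7, K0)); (4, F3, F0, (12, K2))]);
     LMP false [:: 0; 1; 2; 7; 3; 6; 4; 5]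
       (Data [:: false; false; false; false; false]
           [:: 10; 11; 13; 8; 9; 6; 0; 1; 7; 2; 12; 14; 4; 15; 5; 3]);
     LUnslide [:: 0; 5; 1; 2; 3; 6; 4]
       (Slide psI 12 10 true
         [:: (4, F1, F0, (9, K0)); (3, F2, F0, (10, K1))])
       (Data [:: false; false; false; false; true]
           [:: 5; 6; 8; 0; 1; 7; 9; 11; 10; 12; 2; 3; 4]);
     LUnslide [:: 3; 0; 1; 2; 4]
       (Slide psI 5 7 true
         [:: (1, F2, F0, (6, K1)); (2, F1, F2, (7, K1))])
       (Data [:: false; false; false]
           [:: 3; 4; 6; 5; 7; 0; 8; 1; 2])],
     [:: 2; 1; 0])
  | 4, 1 =>
    ([:: LSlide (Slide psII 0 1 true
         [:: (0, F3, F1, (5, K2)); (1, F3, F2, (1, K2))]);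
     LMP true [:: 0; 2; 1; 3]
       (Data [:: false; false]
           [:: 8; 9; 3; 7; 2; 6; 0; 1; 4; 5]);
     LUnslide [:: 3; 0; 1; 2; 4]
       (Slide psI 7 5 true
         [:: (2, F3, F0, (6, K2)); (1, F1, F3, (5, K1))])
       (Data [:: false; true; true]
           [:: 3; 4; 6; 7; 5; 1; 8; 0; 2])],
     [:: 2; 0; 1])
  | 4, 2 =>
    ([:: LSlide (Slide psII 0 2 true
         [:: (0, F0, F2, (5, K0)); (1, F3, F0, (2, K2))]);
     LMP false [:: 3; 2; 0; 1]
       (Data [:: false]
           [:: 6; 4; 7; 1; 2; 0; 5; 3])],
     [:: 0; 1; 2])
  | _, _ => ([::], [::])
  end.

(** The apexes a and b determine the type, because c < d < e are the remaining ranks. All ten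
    non-cyclic types are checked by evaluation. *)
Lemma certificateP m : ~~ mp_cyclic m ->
  chain (piece_data m true) (certificate m).1 (certificate m).2 (piece_data m
    false).
Proof.
apply/implyP; move: m; pose P m := ~~ mp_cyclic m ==>
  chain (piece_data m true) (certificate m).1 (certificate m).2 (piece_data m
    false).
by apply: (@mp_typesP P); vm_compute.
Qed.

(** * Cyclically oriented 2-cells *)

(* [None] when the other face at the edge of T is an in-face as well. *)
Definition thru (sg s : bool) (k : 'I_3) : option (bool * 'I_3) :=
  match sg, s, nat_of_ord k with
  | true, true, 0 => Some (true, K0)
  | true, true, 2 => Some (false, K0)
  | true, false, 1 => Some (true, K1)
  | true, false, 2 => Some (false, K2)
  | false, true, 0 => Some (true, K0)
  | false, true, 1 => Some (false, K1)
  | false, false, 0 => Some (true, K2)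
  | false, false, 2 => Some (false, K2)
  | _, _, _ => None
  end.

Lemma ord3_ind (P : 'I_3 -> Prop) : P K0 -> P K1 -> P K2 -> forall k, P k.
Proof.
move=> P0 P1 P2 [[|[|[|n]]] lt] //; by rewrite (bool_irrelevance lt isT).
Qed.

(** Ties the table [thru] to the geometry: the equations are those of [place_adj] for an in-face and
    an out-face sharing an edge of the tetrahedron. *)
Lemma thruP sg s k s' k' : thru sg s k = Some (s', k') <->
  lift (in_face sg s) k = out_face sg s' /\ lift (out_face sg s') k' = in_face
    sg s.
Proof.
by case: sg; case: s; case: s'; elim/ord3_ind: k; elim/ord3_ind: k';
  split=> [//|[/(congr1 val) // _ /(congr1 val) //]] //= _; split;
    apply: val_inj.
Qed.

(** An edge of a tetrahedron lies on just two of its faces, so the out-face and its side determine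
    the in-face. *)
Lemma thru_inj sg s k s' k' w :
  thru sg s k = Some w -> thru sg s' k' = Some w -> s = s' /\ k = k'.
Proof.
case: sg; case: s; case: s'; elim/ord3_ind: k; elim/ord3_ind: k' => //= <- //.
Qed.

(* The side at position 1 joins the first and the last vertex of the triangle:
   it is the one whose order disagrees with the cyclic order of the vertices. *)
Lemma thru_K1 sg s k s' k' :
  thru sg s k = Some (s', k') -> (k == K1) = (k' == K1).
Proof. by case: sg; case: s; elim/ord3_ind: k => //= -[_ <-]. Qed.

Section Next.
Variables (V I O : finType) (sg : V -> bool).
Implicit Types (x : V * bool + I) (y z : (V * bool + I) * 'I_3).

(** Works on bare connections, so that it applies to [plug_conn] and [slide_conn] before they are
    presented by an o-tangle. *)
Definition go (w : option (V * bool + O)) (k : 'I_3) :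
    option ((V * bool + I) * 'I_3) :=
  if w is Some (inl (v, s)) then
    omap (fun z : bool * 'I_3 => (inl (v, z.1), z.2)) (thru (sg v) s k)
  else None.

Variable c : V * bool + I -> option (V * bool + O).

Definition next_place y := go (c y.1) y.2.

Definition next_closed (S : pred ((V * bool + I) * 'I_3)) : Prop :=
  forall y, S y -> exists z, S z /\ next_place y = Some z.

(** On finitely many places, a nonempty set stable under the everywhere defined step contains a
    cycle. Stable sets are carried along maps of places without control of cycle lengths. *)
Definition recurrent : Prop :=
  exists S : pred ((V * bool + I) * 'I_3), (exists y, S y) /\ next_closed S.

End Next.
Arguments go {V I O}.

Section Places.
Variables (I O : finType) (t : otangle I O).

Definition pnext : place t -> option (place t) :=
  next_place (@sgn _ _ t) (fun x => Some (conn x)).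

Definition trecurrent : Prop := recurrent (@sgn _ _ t) (fun x => Some (conn x)).

Lemma conn_inj : injective (@conn _ _ t).
Proof. exact: bij_inj (@conn_bij _ _ t). Qed.

Lemma pnext_inj y y' z : pnext y = Some z -> pnext y' = Some z -> y = y'.
Proof.
case: y y' => [x k] [x' k']; rewrite /pnext /next_place /=.
case E: (conn x) => [[v s]|//]; case E': (conn x') => [[v' s']|//] /=.
case T: (thru _ s k) => [w|//]; case T': (thru _ s' k') =>
  [w'|//] [<-] [vv w1 w2].
have Ew : w' = w by case: w w' w1 w2 {T T'} => ? ? [? ?] /= -> ->.
rewrite {}vv in T' E'; rewrite {}Ew in T'.
have [ss kk] := thru_inj T T'; rewrite {}kk -{}ss in E' *.
by congr (_, _); apply: conn_inj; rewrite E E'.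
Qed.

(** The step maps the finite set [S] injectively into itself, hence onto itself. *)
Lemma next_closed_prev (S : pred (place t)) :
  next_closed (@sgn _ _ t) (fun x => Some (conn x)) S ->
  forall z, S z -> exists2 y, S y & pnext y = Some z.
Proof.
(* The default of [odflt] is never reached on [S]. *)
move=> cl z Sz; pose g y := odflt y (pnext y).
have gE y : S y -> S (g y) /\ pnext y = Some (g y).
  by move=> /cl[w [Sw E]]; rewrite /g [pnext y]E.
pose A := [set y | S y].
have inj : {in A &, injective g}.
  move=> y y'; rewrite !inE => /gE[_ E] /gE[_ E'] gg.
  by apply: (pnext_inj E); rewrite E' gg.
have /eqP AE : g @: A == A.
  rewrite eqEcard card_in_imset // leqnn andbT.
  by apply/subsetP => _ /imsetP[y + ->]; rewrite !inE => /gE[].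
have : z \in A by rewrite inE.
by rewrite -{1}AE => /imsetP[y]; rewrite inE => Sy ->; exists y => //;
  have [] := gE _ Sy.
Qed.

Lemma out_face_inj sg : injective (out_face sg).
Proof. by case: sg => -[] [] // /(congr1 val). Qed.
Lemma in_face_inj sg : injective (in_face sg).
Proof. by case: sg => -[] [] // /(congr1 val). Qed.
Lemma in_out_face sg s s' : in_face sg s != out_face sg s'.
Proof. by case: sg; case: s; case: s'. Qed.

(** A stable set is also stable backwards, and two adjacent places of which one lies in it are
    consecutive on a track; [thru_K1] gives the second claim. *)
Lemma next_closed_adj (S : pred (place t)) y z :
  next_closed (@sgn _ _ t) (fun x => Some (conn x)) S ->
  S y -> place_adj y z -> S z /\ (y.2 == K1) = (z.2 == K1).
Proof.
case: y z => [x k] [x' k'] cl Sy.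
move=> /existsP[v /existsP[f /existsP[f' /and4P[Fx Fx' /eqP E /eqP E']]]].
move: E E' => /= E E'.
have face_in w s : conn w = inl (v, s) -> is_face w v (in_face (sgn v) s).
  by move=> cw; rewrite /is_face cw !eqxx orbT.
have out_of s w : is_face w v (out_face (sgn v) s) -> w = inl (v, s).
  rewrite /is_face => /orP[].
    by case: w => [[u r]|//] /andP[/eqP -> /eqP/out_face_inj ->].
  by case: (conn w) => [[u r]|//] /andP[_]; rewrite (negPf (in_out_face _ _ _)).
have in_of s w : is_face w v (in_face (sgn v) s) -> conn w = inl (v, s).
  rewrite /is_face => /orP[].
    case: w => [[u r]|//] /andP[_]; by rewrite eq_sym (negPf (in_out_face _ _
      _)).
  by case: (conn w) => [[u r]|//] /andP[/eqP -> /eqP/in_face_inj ->].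
case/orP: (Fx).
  (* [f] is an out-face of [v]: the adjacent place is the predecessor. *)
  case Ex: x => [[u s]|//] /andP[/eqP Eu /eqP Ef]; rewrite {}Eu {u} in Ex.
  have [[w r] /= Sw] := next_closed_prev cl Sy.
  rewrite /pnext /next_place Ex /=; case Ew: (conn w) => [[u p]|//] /=.
  case T: (thru _ _ _) => [[s0 k0]|//] /= -[Eu Es Ek].
  rewrite Eu {Eu u} in Ew T; rewrite Es {Es s0} Ek {Ek k0} in T.
  have [T1 T2] := (thruP _ _ _ _ _).1 T.
  have Ef' : f' = in_face (sgn v) p by rewrite -E -Ef.
  rewrite Ef' in Fx' E'; move: (in_of _ _ Fx') => Ex'.
  have xw : x' = w by apply: conn_inj; rewrite Ex' Ew.
  have kr : k' = r by apply: (@lift_inj _ (in_face (sgn v) p));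
    rewrite E' T1 Ef.
  by rewrite xw kr; split=> //; rewrite (thru_K1 T).
(* [f] is an in-face of [v]: the adjacent place is the successor. *)
case Ex: (conn x) => [[u s]|//] /andP[/eqP Eu /eqP Ef]; rewrite {}Eu {u} in Ex.
have [[w r] [Sw]] := cl _ Sy; rewrite /next_place /= Ex /=.
case T: (thru _ _ _) => [[s0 k0]|//] /= -[Ew Er].
have [T1 T2] := (thruP _ _ _ _ _).1 T.
have Ef' : f' = out_face (sgn v) s0 by rewrite -E -Ef.
rewrite Ef' in Fx' E'; move: (out_of _ _ Fx') => /= Ex'.
have kk : k' = k0 by apply: (@lift_inj _ (out_face (sgn v) s0));
  rewrite E' T2 Ef.
by rewrite Ex' kk Ew Er; split=> //; rewrite -Er (thru_K1 T).
Qed.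

Lemma place_adj_sym : symmetric (@place_adj _ _ t).
Proof.
suff half (y z : place t) : place_adj y z -> place_adj z y.
  by move=> y z; apply/idP/idP; exact: half.
move=> /existsP[v /existsP[f /existsP[f' /and4P[? ? ? ?]]]].
by apply/existsP; exists v; apply/existsP; exists f'; apply/existsP;
  exists f; apply/and4P.
Qed.

(** A stable set contains all or none of the places at an edge of T, and in the first case all
    triangles are crossed there in the same sense. *)
Lemma next_closed_edge (S : pred (place t)) y z :
  next_closed (@sgn _ _ t) (fun x => Some (conn x)) S ->
  S y -> same_edge y z -> S z /\ (y.2 == K1) = (z.2 == K1).
Proof.
move=> cl + /connectP[p + ->]; elim: p y => //= w p IH y Sy /andP[yw pw].
have [Sw ->] := next_closed_adj cl Sy yw; exact: IH.
Qed.

End Places.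

Lemma recurrent_presents (V I O : finType) (sg : V -> bool) c
    (t : otangle I O) :
  presents sg c t -> recurrent sg c <-> trecurrent t.
Proof.
move=> [f [[g fK gK] sE cE]].
pose up (y : (V * bool + I) * 'I_3) : place t := (ren f y.1, y.2).
pose dn (y : place t) : (V * bool + I) * 'I_3 := (ren g y.1, y.2).
have upK : cancel up dn.
  by move=> [[[v s]|i] k]; rewrite /dn /up /= ?fK.
have dnK : cancel dn up.
  by move=> [[[v s]|i] k]; rewrite /dn /up /= ?gK.
have nE y : pnext (up y) = omap up (next_place sg c y).
  case: y => x k; rewrite /pnext /next_place /=; have := cE x.
  case: (c x) => //= w [<-]; case: w => [[v s]|//] /=.
  by rewrite sE; case: (thru _ _ _).
split=> -[S [[y Sy] cl]].
  exists (S \o dn); split; first by exists (up y); rewrite /= upK.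
  move=> z /cl[w [Sw nw]]; exists (up w); rewrite /= upK; split=> //.
  by have := nE (dn z); rewrite dnK nw.
exists (S \o up); split; first by exists (dn y); rewrite /= dnK.
move=> z /cl[w [Sw]]; rewrite -/pnext => nw.
have : omap up (next_place sg c z) = Some w by rewrite -nE.
case: (next_place sg c z) => //= w' [w'E]; exists w'; split=> //.
by rewrite /= w'E.
Qed.

(** * Cyclic 2-cells under non-cyclic sliding moves *)

Section Slide.
Variables (I O : finType) (t : otangle I O) (k : ps_type).
Variables (x1 x2 : vert t * bool + I) (fst1 : bool) (k1 k2 : 'I_3).
Let p := ps_p k.
Let q := ps_q k.
Hypotheses (nck : ~~ ps_cyclic k) (K1E : lift q k1 = p) (K2E : lift p k2 = q).
Hypothesis same : same_edge ((x1, k1) : place t) ((x2, k2) : place t).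

Let sg := @slide_sgn _ _ t.
Let c x := Some (slide_conn k x1 x2 fst1 x).
Let goS := @go _ I O sg.
Let splace := (((vert t + bool) * bool + I) * 'I_3)%type.

Let emb (y : place t) : splace := (ren inl y.1, y.2).
Let out (f : 'I_4) : (vert t + bool) * bool + I := inl (inr (odd f), f < 2).

Let out_sideE (f : 'I_4) : out_face (odd f) (f < 2) = f.
Proof. by case: f => [[|[|[|[|n]]]] lt] //; apply: val_inj. Qed.

Let go_emb w i : goS (Some (ren inl w)) i
  = omap emb (@go _ I O (@sgn _ _ t) (Some w) i).
Proof. by case: w => [[v s]|o] //=; case: (thru _ _ _). Qed.

(** For [psI] and [psII] the edge xy joins the first and last vertices of exactly one of f_1 and
    f_2; for [psIII] it does so in neither, for [psIV] in both. *)
Let parity : (k1 == K1) != (k2 == K1).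
Proof.
move: K1E K2E; rewrite /p /q; case: (k) nck => // _;
elim/ord3_ind: (k1) => /(congr1 val) //;
elim/ord3_ind: (k2) => _ /(congr1 val) //.
Qed.

(* A place in the pillow is in the set when the end of its track is. *)
Definition slid_set (S : pred (place t)) (y : splace) : bool :=
  match y.1 with
  | inl (inl v, s) => S (inl (v, s), y.2)
  | inr i => S (inr i, y.2)
  | inl (inr b, s) =>
      let f := out_face b s in
      if f == q then S (x1, y.2)
      else if f == p then S (x2, y.2)
      else if thru (~~ odd f) (f < 2) y.2 is Some (s', k') then
        if out_face (~~ odd f) s' == q then S (x1, k') else S (x2, k')
      else false
  end.

(** By [parity], no stable set contains the places of f_1 and f_2 at xy. As the ranks of p and q
    have equal parity, f_1 and f_2 both enter one crossing of the pillow and leave from the other;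
    any track not at xy crosses both and returns to its triangle at the same position. *)
Lemma recurrent_slide : trecurrent t -> recurrent sg c.
Proof.
move=> [S [ne cl]].
have S'emb y : slid_set S (emb y) = S y by case: y => [[[v s]|i] j].
have n1 : ~~ S (x1, k1).
  apply: contra parity => S1; apply/eqP.
  by have [_ E] := next_closed_edge cl S1 same; exact: E.
have n2 : ~~ S (x2, k2).
  apply: contra parity => S2.
  have sym : same_edge ((x2, k2) : place t) (x1, k1).
    by move: same; rewrite /same_edge (sym_connect_sym (@place_adj_sym _ _ t)).
  by apply/eqP; have [_ E] := next_closed_edge cl S2 sym; rewrite [LHS](esym E).
have in_q i : S (x1, i) -> exists z, slid_set S z /\
    goS (Some (pillow_in t q)) i = Some z.
  move: n1 K1E; rewrite /slid_set /q /p; case: (k) nck => // _;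
  elim/ord3_ind: (k1) => n1' /(congr1 val) // _;
  elim/ord3_ind: i; rewrite ?(negPf n1') // => Si;
  by eexists; split; [|reflexivity].
have in_p i : S (x2, i) -> exists z, slid_set S z /\
    goS (Some (pillow_in t p)) i = Some z.
  move: n2 K2E; rewrite /slid_set /q /p; case: (k) nck => // _;
  elim/ord3_ind: (k2) => n2' /(congr1 val) // _;
  elim/ord3_ind: i; rewrite ?(negPf n2') // => Si;
  by eexists; split; [|reflexivity].
have exit x i : S (x, i) -> exists z, slid_set S z /\
    goS (Some (ren inl (conn x))) i = Some z.
  move=> /cl[z [Sz nz]]; exists (emb z); rewrite S'emb; split=> //.
  rewrite go_emb.
  by rewrite -[go _ _ _]/(next_place _ (fun x => Some (conn x)) (x, i)) nz.
have start x i : S (x, i) -> exists z, slid_set S z /\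
    goS (Some (slide_start k x1 x2 fst1 x)) i = Some z.
  move=> Sx; rewrite /slide_start; case: ifP => [/andP[/eqP E _]|_].
    by apply: in_q; rewrite -E.
  by case: ifP => [/eqP E|_]; [apply: in_p; rewrite -E|exact: exit].
exists (slid_set S); split.
  by have [y Sy] := ne; exists (emb y); rewrite S'emb.
case=> -[[[v|b] s]|i] j; rewrite /next_place /c /slide_conn.
- exact: start.
- rewrite {1}/slid_set -/p -/q [_.1]/= [_.2]/=.
  case: ifP => fq.
    move=> S1; rewrite [_ == q]fq; case: ifP => [/andP[/eqP E _]|_];
      last exact: exit.
    by apply: in_p; rewrite -E.
  case: ifP => fp.
    move=> S2; rewrite [_ == q]fq; case: ifP => [/andP[/eqP E _]|_];
      last exact: exit.
    by apply: in_q; rewrite E.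
  move: fq fp; rewrite /slid_set /q /p; case: (k) nck => // _; case: b;
    case: s => //= _ _;
  elim/ord3_ind: j => //= Sx; by eexists; split; [|reflexivity].
- exact: start.
Qed.

(** Tracks entering the pillow at xy stop, as both faces there are in-faces, so a stable set uses
    only passages that keep triangle and position; these are cut out. *)
Lemma recurrent_unslide : recurrent sg c -> trecurrent t.
Proof.
move=> [S [[y0 Sy0] cl]].
have kE : k = psI \/ k = psII by case: (k) nck; auto.
have outE (f : 'I_4) : out_face (odd f) (f < 2) = f := out_sideE f.
have pq : (p == q) = false by rewrite /p /q; case: (k).
have cq : slide_conn k x1 x2 fst1 (out q)
    = if (x1 == x2) && fst1 then pillow_in t p else ren inl (conn x1).
  by rewrite /out /slide_conn outE -/p -/q eqxx.
have cp : slide_conn k x1 x2 fst1 (out p)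
    = if (x1 == x2) && ~~ fst1 then pillow_in t q else ren inl (conn x2).
  by rewrite /out /slide_conn outE -/p -/q pq eqxx.
have in_q x i : S (x, i) -> slide_conn k x1 x2 fst1 x = pillow_in t q ->
  S (out q, i).
  move=> Sx cx; have [z [Sz]] := cl _ Sx.
  rewrite /next_place /c [_.1]/= [_.2]/= cx; move: Sz; rewrite /q /p.
  case: kE => kE; rewrite kE; elim/ord3_ind: i {Sx cx} => //= Sz [zE];
  rewrite -zE in Sz; have [z' [+]] := cl _ Sz;
  rewrite /next_place /c kE /= => + [zE']; rewrite -zE'; exact.
have in_p x i : S (x, i) -> slide_conn k x1 x2 fst1 x = pillow_in t p ->
  S (out p, i).
  move=> Sx cx; have [z [Sz]] := cl _ Sx.
  rewrite /next_place /c [_.1]/= [_.2]/= cx; move: Sz; rewrite /q /p.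
  case: kE => kE; rewrite kE; elim/ord3_ind: i {Sx cx} => //= Sz [zE];
  rewrite -zE in Sz; have [z' [+]] := cl _ Sz;
  rewrite /next_place /c kE /= => + [zE']; rewrite -zE'; exact.
have back w i x : S (x, i) -> slide_conn k x1 x2 fst1 x = ren inl w ->
    exists z, S (emb z) /\ @go _ I O (@sgn _ _ t) (Some w) i = Some z.
  move=> /cl[z [Sz zE]] xE.
  have : goS (Some (ren inl w)) i = Some z by rewrite -xE; exact: zE.
  rewrite go_emb; case: (go _ _ _) => // z' [z'E].
  by exists z'; rewrite z'E.
(* If f_1 and f_2 are parallel copies, the track may traverse the pillow a second time, through the
   other copy. *)
have q_back x i : S (x, i) -> x = out q -> exists z,
    S (emb z) /\ @go _ I O (@sgn _ _ t) (Some (conn x1)) i = Some z.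
  move=> Sx xE; rewrite xE in Sx; move: cq.
  case: ifP => [/andP[/eqP xx f1] cq'|_ cq']; last exact: back Sx cq'.
  have Sp := in_p _ _ Sx cq'; move: cp; rewrite ifF => [cp'|];
    last by rewrite f1 andbF.
  rewrite xx.
  exact: back Sp cp'.
have p_back x i : S (x, i) -> x = out p -> exists z,
    S (emb z) /\ @go _ I O (@sgn _ _ t) (Some (conn x2)) i = Some z.
  move=> Sx xE; rewrite xE in Sx; move: cp.
  case: ifP => [/andP[/eqP xx f1] cq'|_ cq']; last exact: back Sx cq'.
  have Sp := in_q _ _ Sx cq'; move: cq; rewrite ifF => [cp'|];
    last by rewrite (negPf f1) andbF.
  rewrite -xx.
  exact: back Sp cp'.
exists (fun y => S (emb y)); split.
  (* For nonemptiness, a place of [S] inside the pillow is followed until it leaves. *)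
  have pil b s i : S (inl (inr b, s), i) -> exists y, S (emb y).
    have fin x l : S (x, l) -> x = out q \/ x = out p -> exists y, S (emb y).
      by move=> Sx [/(q_back _ _ Sx)|/(p_back _ _ Sx)] [y [Sy _]]; exists y.
    have [bq|nbq] := eqVneq (out_face b s) q.
      by move=> /fin; apply; left; rewrite -bq; case: (b); case: (s).
    have [bp|nbp] := eqVneq (out_face b s) p.
      by move=> /fin; apply; right; rewrite -bp; case: (b); case: (s).
    move=> /cl[z [Sz]]; move: nbq nbp; rewrite /next_place /c /q /p.
    case: kE => kE; rewrite kE; case: b; case: s => //= _ _;
    elim/ord3_ind: i => //= -[zE]; rewrite -zE in Sz; apply: (fin _ _ Sz);
    by rewrite /q /p kE; by [left|right].
  case: y0 Sy0 => -[[[v|b] s]|i] j Sy0; last by exists (inr i, j).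
    by exists (inl (v, s), j).
  exact: pil Sy0.
move=> [x i] Sx.
have cx : slide_conn k x1 x2 fst1 (ren inl x) = slide_start k x1 x2 fst1 x.
  by case: (x) => [[]|].
move: cx; rewrite /slide_start; case: ifP => [/andP[/eqP E _] cx|_].
  have [z [Sz zE]] := q_back _ _ (in_q _ _ Sx cx) erefl.
  by exists z; split=> //; rewrite /next_place E.
case: ifP => [/eqP E cx|_ cx].
  have [z [Sz zE]] := p_back _ _ (in_p _ _ Sx cx) erefl.
  by exists z; split=> //; rewrite /next_place E.
exact: back Sx cx.
Qed.

End Slide.

(** * Tracks through a composition *)

Section Fate.
Variables (I O : finType) (t : otangle I O).

(** The outgoing boundary place reached by the track, if any, with [n] as fuel. *)
Fixpoint fate n (y : place t) : option (O * 'I_3) :=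
  match conn y.1 with
  | inr o => Some (o, y.2)
  | inl _ => if n is n'.+1 then obind (fate n') (pnext y) else None
  end.

Definition dies n : Prop :=
  forall y : place t, iter n (obind (@pnext _ _ t)) (Some y) = None.

Lemma fate_fuel n y : iter n (obind (@pnext _ _ t)) (Some y) = None ->
  fate n.+1 y = fate n y.
Proof.
elim: n y => // n IH y; rewrite iterSr /= => E.
case: (conn y.1) => // _; case Ey: (pnext y) E => [z|//] /= E.
by have /= := IH _ E.
Qed.

(** Once all tracks have died the fuel no longer matters, so the recursion holds with constant
    fuel. *)
Lemma fate_next n y w : dies n -> conn y.1 = inl w ->
  fate n y = obind (fate n) (pnext y).
Proof. by move=> d yw; rewrite -fate_fuel //= yw. Qed.

Lemma fate_exit n y o : conn y.1 = inr o -> fate n y = Some (o, y.2).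
Proof. by case: n => [|n] /= ->. Qed.

Lemma next_closed_dies n (S : pred (place t)) :
  next_closed (@sgn _ _ t) (fun x => Some (conn x)) S -> dies n ->
    forall y, ~~ S y.
Proof.
move=> cl d y; apply/negP => Sy.
have [z [_]] : exists z, S z /\ iter n (obind (@pnext _ _ t)) (Some y) = Some z.
  elim: n {d} => [|n [z [/cl[w [Sw nz]] E]]]; first by exists y.
  by exists w; rewrite /= E.
by rewrite d.
Qed.

End Fate.

Section Tracks.
Variables (I0 O0 I O : finType) (X : otangle (O0 + I)%type (I0 + O)%type).

(** The step of the outer tangle, with the whole passage through the hole summarized by [F]; the
    inner tangle then matters only through its [fate]. *)
Definition hop (F : I0 -> 'I_3 -> option (O0 * 'I_3)) (y : place X) :
    option (place X) :=
  match conn y.1 with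
  | inr (inl i) => omap (fun z => (inr (inl z.1), z.2)) (F i y.2)
  | _ => pnext y
  end.

Definition hop_recurrent F : Prop := exists S : pred (place X),
  (exists y, S y) /\ forall y, S y -> exists z, S z /\ hop F y = Some z.

Variables (u : otangle I0 O0) (n : nat).
Hypotheses (du : dies u n) (au : arcless u).
Let F i k := fate n ((inr i, k) : place u).
Let pplace := (((vert X + vert u) * bool + I) * 'I_3)%type.
Let c := @plug_conn _ _ _ _ X u.
Let sg := @plug_sgn _ _ _ _ X u.

(* The place of the outer tangle at which the track of a place first leaves the
   inner one. *)
Definition leads (y : pplace) : option (place X) :=
  match y.1 with
  | inl (inl v, s) => Some (inl (v, s), y.2)
  | inl (inr v, s) =>
      omap (fun z => (inr (inl z.1), z.2))
           (fate n ((inl (v, s), y.2) : place u))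
  | inr i => Some (inr (inr i), y.2)
  end.

Let enter_next (z : place X) : option pplace :=
  @go _ I O sg (@enter _ _ _ _ X u (conn z.1)) z.2.

Lemma hop_enter z : obind leads (enter_next z) = hop F z.
Proof.
case: z => x k; rewrite /enter_next /hop /pnext /next_place /=.
case: (conn x) => [[v s]|[i|o]] //=.
  by case: (thru _ _ _).
have [[w s] wE] := au i.
rewrite wE /F (fate_next (y := (inr i, k)) du wE) /pnext /next_place /= wE /=.
by case: (thru _ _ _).
Qed.

Lemma leads_inner v s k w : conn (inl (v, s) : vert u * bool + I0) = inl w ->
  obind leads (next_place sg c (inl (inr v, s), k)) = leads (inl (inr v, s), k).
Proof.
case: w => w r E; rewrite /leads /next_place /= E.
rewrite (fate_next (y := (inl (v, s), k)) du E) /pnext /next_place /= E /=.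
by case: (thru _ _ _).
Qed.

(** A step either stays on the same passage through the hole, or is the step of the outer place to
    which the track leads. *)
Lemma leads_next y :
  obind leads (next_place sg c y) = leads y
  \/ exists2 z, leads y = Some z & next_place sg c y = enter_next z.
Proof.
case: y => [[[[v|v] s]|i] k].
- by right; exists (inl (v, s), k).
- case E: (conn (inl (v, s) : vert u * bool + I0)) => [w|o].
    by left; exact: leads_inner E.
  right; exists (inr (inl o), k).
    by rewrite /leads /= (fate_exit (y := (inl (v, s), k)) _ E).
  by rewrite /next_place /= E.
- by right; exists (inr (inr i), k).
Qed.

Lemma leads_surj z : exists y, leads y = Some z.
Proof.
case: z => [[[v s]|[o|i]] k].
- by exists (inl (inl v, s), k).
(* Some edge of [u] ends at [o]; it starts at a crossing because [u] is arcless. *)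
- have [g _ gK] := @conn_bij _ _ u; case E: (g (inr o)) => [[v s]|i].
    exists (inl (inr v, s), k); rewrite /leads /= (fate_exit _ (o := o)) //.
    by rewrite /= -E gK.
  by have [w] := au i; rewrite -E gK.
- by exists (inr i, k).
Qed.

(** A track inside the hole cannot stop, being in a stable set, nor stay inside, by [dies]; so it
    leaves. *)
Lemma next_closed_leads (S : pred pplace) y : next_closed sg c S -> S y ->
  exists z ye, [/\ leads y = Some z, S ye & next_place sg c ye = enter_next z].
Proof.
move=> cl; case: y => [[[[v|v] s]|i] k] Sy.
- by exists (inl (v, s), k), (inl (inl v, s), k).
(* Induction on the remaining lifetime only: the fuel in [leads] stays [n]. *)
- have := du (inl (v, s), k); elim: {1}(n) v s k Sy => // m IH v s k Sy.
  rewrite iterSr /=; case E: (conn (inl (v, s) : vert u * bool + I0)) =>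
    [[w r]|o].
    have [y' [Sy' ny]] := cl _ Sy.
    have ly : leads (inl (inr v, s), k) = leads y'.
      by rewrite -(leads_inner k E) ny.
    move: ny; rewrite /pnext /next_place /= E /=;
      case: (thru _ _ _) => // w' [y'E].
    rewrite -y'E in Sy' ly; move=> /(IH _ _ _ Sy')[z [ye [lz Sye nye]]].
    by exists z, ye; split=> //; rewrite ly.
  move=> _; exists (inr (inl o), k), (inl (inr v, s), k); split=> //.
    by rewrite /leads /= (fate_exit (y := (inl (v, s), k)) _ E).
  by rewrite /next_place /= E.
- by exists (inr (inr i), k), (inr i, k).
Qed.

(** Stable sets are pushed forward along [leads] in one direction and pulled back in the other. *)
Lemma recurrent_plug : recurrent sg c <-> hop_recurrent F.
Proof.
split=> -[S [[y Sy] cl]].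
  pose T z := [exists y, S y && (leads y == Some z)].
  have TI x z : S x -> leads x = Some z -> T z.
    by move=> Sx lx; apply/existsP; exists x; rewrite Sx lx /=.
  exists T; split.
    by have [z [_ [lz _ _]]] := next_closed_leads cl Sy; exists z; exact: TI lz.
  move=> z /existsP[x /andP[Sx /eqP lx]].
  have [z' [ye []]] := next_closed_leads cl Sx; rewrite lx => -[<-] Sye nye.
  have [x' [Sx' nx]] := cl _ Sye; have [z2 [_ [lz2 _ _]]] :=
    next_closed_leads cl Sx'.
  by exists z2; split; [exact: TI lz2|rewrite -hop_enter -nye nx].
exists (fun x => if leads x is Some z then S z else false); split.
  by have [x lx] := leads_surj y; exists x; rewrite lx.
move=> x; case lx: (leads x) => [z|//] Sz.
case: (leads_next x) => [|[z0]]; rewrite lx.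
  by case: (next_place sg c x) => // x' /= lx'; exists x'; rewrite lx'.
move=> [<-] ->; have [z' [Sz' hz]] := cl _ Sz; move: hz; rewrite -hop_enter.
by case: (enter_next z) => // x' /= lx'; exists x'; rewrite lx'.
Qed.

End Tracks.

(** Equal fates give the same [hop] on the common outer tangle. *)
Lemma recurrent_replaces (I0 O0 I O : finType) n (u u' : otangle I0 O0)
    (t t' : otangle I O) :
  dies u n -> dies u' n -> arcless u -> arcless u' ->
  (forall i k,
     fate n ((inr i, k) : place u) = fate n ((inr i, k) : place u')) ->
  replaces u u' t t' -> trecurrent t <-> trecurrent t'.
Proof.
move=> d d' a a' E [X [p p']].
have := recurrent_presents p; have := recurrent_presents p'.
have := recurrent_plug X d a; have := recurrent_plug X d' a'.
have H F F' : (forall i k, F i k = F' i k) -> hop_recurrent X F ->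
  hop_recurrent X F'.
  move=> FE [S [ne cl]]; exists S; split=> // y /cl[z [Sz hz]].
  by exists z; split=> //; rewrite -hz /hop; case: (conn _) => // -[] // i;
    rewrite FE.
have := H _ _ E; have := H _ _ (fun i k => esym (E i k)); tauto.
Qed.

(** * Tracks computed on tables *)

Section DataTracks.
Variables (a : nat) (D : data).

Definition dnext (y : nat * 'I_3) : option (nat * 'I_3) :=
  let w := nth 0 (table D) y.1 in
  if w < a then None
  else let v := (w - a)./2 in
    omap (fun z : bool * 'I_3 => (a + v.*2 + z.1, z.2))
         (thru (nth true (signs D) v) (odd (w - a)) y.2).

Fixpoint dfate n (y : nat * 'I_3) : option (nat * 'I_3) :=
  let w := nth 0 (table D) y.1 in
  if w < a then Some (w, y.2)
  else if n is n'.+1 then obind (dfate n') (dnext y) else None.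

Definition dplaces (N : nat) := [seq (x, k) | x <- iota 0 N, k <- [:: K0; K1;
  K2]].

Definition ddies n : bool :=
  all (fun y => iter n (obind dnext) (Some y) == None)
      (dplaces (a + (size (signs D)).*2)).

Definition dperiodic n : bool :=
  has (fun y => iter n (obind dnext) (Some y) == Some y)
      (dplaces (a + (size (signs D)).*2)).

Lemma mem_dplaces N x k : ((x, k) \in dplaces N) = (x < N).
Proof.
apply/allpairsP/idP => [[[x' k'] /= [+ _ [-> _]]]|lx];
  first by rewrite mem_iota.
by exists (x, k); rewrite /= mem_iota lx; split=> //; elim/ord3_ind: k.
Qed.

Variables (I O : finType) (rI : I -> nat) (rO : O -> nat) (t : otangle I O).
Hypotheses (nI : numbers a rI) (nO : numbers a rO).

Variable rV : vert t -> nat.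
Hypothesis nV : numbers (size (signs D)) rV.
Hypothesis sV : forall v, sgn v = nth true (signs D) (rV v).
Hypothesis cV : forall x,
  ecode a rV rO (conn x) = nth 0 (table D) (ecode a rV rI x).

Let enc (y : place t) : nat * 'I_3 := (ecode a rV rI y.1, y.2).

Let enc_inj : injective enc.
Proof.
have [i _ _] := numbers_ecode nV nI.
by move=> [x k] [x' k'] [/i /= -> ->].
Qed.

Let enc_pnext y : dnext (enc y) = omap enc (pnext y).
Proof.
case: y => x k; rewrite /dnext /pnext /next_place /= -cV.
case: (conn x) => [[v s]|o] /=; last by have [_ -> _] := nO.
rewrite ifN; last by lia.
have -> : a + (rV v).*2 + s - a = s + (rV v).*2 by lia.
rewrite half_bit_double oddD odd_double addbF oddb -sV.
by case: (thru _ _ _).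
Qed.

Let enc_iter n y : iter n (obind dnext) (Some (enc y))
  = omap enc (iter n (obind (@pnext _ _ t)) (Some y)).
Proof.
by elim: n => //= n ->; case: (iter _ _ _) => //= z; rewrite enc_pnext.
Qed.

Lemma dies_encode n : ddies n -> dies t n.
Proof.
move=> /allP d y; have [_ l _] := numbers_ecode nV nI.
have := d (enc y); rewrite mem_dplaces l => /(_ isT); rewrite enc_iter.
by case: (iter _ _ _).
Qed.

Lemma fate_encode n y :
  dfate n (enc y) = omap (fun z => (rO z.1, z.2)) (fate n y).
Proof.
elim: n y => [|n IH] y /=; rewrite -cV; case E: (conn y.1) => [[v s]|o] /=.
- by rewrite ifN //; lia.
- by have [_ -> _] := nO.
- rewrite ifN; last by lia.
  by rewrite enc_pnext; case: (pnext y).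
- by have [_ -> _] := nO.
Qed.

(** The orbit of a periodic place is a stable set. *)
Lemma periodic_encode n : dperiodic n.+1 -> trecurrent t.
Proof.
move=> /hasP[[x k] + /eqP]; rewrite mem_dplaces => lx per.
have [_ _ s] := numbers_ecode nV nI; have [w /eqP wx] := s _ lx.
have {}per : iter n.+1 (obind (@pnext _ _ t)) (Some (w, k)) = Some (w, k).
  move: per; rewrite -wx -[(_, k)]/(enc (w, k)) enc_iter.
  by case: (iter _ _ _) => // z /Some_inj/enc_inj ->.
pose S z := [exists j : 'I_n.+1, iter j (obind (@pnext _ _ t)) (Some (w, k)) ==
  Some z].
exists S; split; first by exists (w, k); apply/existsP; exists ord0.
move=> z /existsP[j /eqP jE].
have jS : iter j.+1 (obind (@pnext _ _ t)) (Some (w, k)) = pnext z by rewrite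
  /= jE.
(* Before the end of the period the step is defined, since a later iterate is not [None]. *)
have [jn|jn] := ltnP j.+1 n.+1.
  have ljn : j.+1 < n.+1 := jn.
  have : iter n.+1 (obind (@pnext _ _ t)) (Some (w, k)) != None by rewrite per.
  rewrite -(subnK (ltnW ljn)) iterD jS; case nz: (pnext z) => [z'|]; last first.
    by rewrite (_ : iter _ _ None = None) //; elim: (_ - _) => //= l ->.
  move=> _; exists z'; split; last exact: nz.
  by apply/existsP; exists (Ordinal ljn); rewrite /= -nz -jS.
(* The last iterate steps back to the starting place. *)
exists (w, k); split; first by apply/existsP; exists ord0.
have jn' : j.+1 = n.+1 by have := ltn_ord j; lia.
by rewrite -per -jn' jS.
Qed.

End DataTracks.

(** * Effect of the moves on cyclic 2-cells *)

Definition mp_tracks_ok (m : mp_type) : bool :=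
  let D two := piece_data m two in
  ddies 3 (D true) 6
  && if mp_cyclic m then dperiodic 3 (D false) 3 else
     ddies 3 (D false) 6
     && all (fun y => dfate 3 (D true) 6 y == dfate 3 (D false) 6 y) (dplaces
       3).

(** The bound 6 outlasts every track that dies; the period 3 counts the tetrahedra around ab;
    [dplaces 3] holds the places at the three incoming boundary triangles. *)
Lemma mp_tracks_okT m : mp_tracks_ok m.
Proof. by apply: mp_typesP m; vm_compute. Qed.

Lemma mp_src_not_recurrent m : ~ trecurrent (mp_src m).
Proof.
have /andP[d _] := mp_tracks_okT m.
have [rV [nV sV cV]] := encodes_piece m true.
have {}d := dies_encode (rank_in_numbers m) (rank_out_numbers m) nV sV cV d.
by move=> [S [[y Sy] cl]]; have := next_closed_dies cl d y; rewrite Sy.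
Qed.

Lemma mp_tgt_recurrent m : mp_cyclic m -> trecurrent (mp_tgt m).
Proof.
move=> cm; have := mp_tracks_okT m; rewrite /mp_tracks_ok cm => /andP[_ per].
have [rV [nV sV cV]] := encodes_piece m false.
exact: (@periodic_encode 3 _ _ _ _ _ (piece m false) (rank_in_numbers m)
  (rank_out_numbers m) rV nV sV cV 2 per).
Qed.

Lemma mp_step_recurrent m (I O : finType) (t t' : otangle I O) :
  ~~ mp_cyclic m -> mp_step m t t' -> trecurrent t <-> trecurrent t'.
Proof.
move=> nc; have /andP[d] := mp_tracks_okT m.
rewrite (negPf nc) => /andP[d' /allP fE].
have ni := rank_in_numbers m; have no := rank_out_numbers m.
have [rV [nV sV cV]] := encodes_piece m true.
have [rV' [nV' sV' cV']] := encodes_piece m false.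
have {}d := dies_encode ni no nV sV cV d.
have {}d' := dies_encode ni no nV' sV' cV' d'.
apply: (recurrent_replaces d d' (@piece_arcless _ _) (@piece_arcless _ _)).
move=> i k; have [_ li _] := ni; have [ino _ _] := no.
have := fE (rank_in i, k); rewrite mem_dplaces li => /(_ isT)/eqP.
have /= -> := fate_encode no sV cV 6 (inr i, k).
have /= -> := fate_encode no sV' cV' 6 (inr i, k).
apply: inj_omap => -[o l] [o' l'] /= [/ino -> ->] //.
Qed.

Lemma ps_step_recurrent k (I O : finType) (t t' : otangle I O) :
  ~~ ps_cyclic k -> ps_step k t t' -> trecurrent t <-> trecurrent t'.
Proof.
move=> nc [x1 [x2 [k1 [k2 [fst1 [K1E K2E same p]]]]]].
apply: iff_trans (recurrent_presents p); split.
  exact: recurrent_slide nc K1E K2E same.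
exact: recurrent_unslide.
Qed.

Lemma step_recurrent mv (I O : finType) (t t' : otangle I O) :
  ~~ cyclic mv -> step mv t t' -> trecurrent t <-> trecurrent t'.
Proof. by case: mv => [m|k]; [exact: mp_step_recurrent|exact:
  ps_step_recurrent]. Qed.

Lemma sequence_recurrent s (I O : finType) (t t' : otangle I O) :
  all (fun r => ~~ cyclic r.1) s -> sequence s t t' ->
  trecurrent t <-> trecurrent t'.
Proof.
elim: s t => [|[mv d] s IH] t /=; first by move=> _ /recurrent_presents.
move=> /andP[nc ncs] [v [st /(IH _ ncs)]]; apply: iff_trans.
by case: d st => st; [|apply: iff_sym]; exact: step_recurrent nc st.
Qed.

(** Non-cyclic moves would carry the cycle of the target back to the source, which has none. *)
Lemma cyclic_mp_not_represented s m :
  mp_cyclic m -> represents_mp s m -> ~~ all (fun r => ~~ cyclic r.1) s.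
Proof.
move=> cm rep; apply/negP => nc.
have /(sequence_recurrent nc)[_ back] := rep.
exact: mp_src_not_recurrent (back (mp_tgt_recurrent cm)).
Qed.

Lemma primary_noncyclic m : is_primary m -> ~~ mp_cyclic m.
Proof. by move=> /is_primaryE ->. Qed.

Theorem propositionB1 :
  [/\ (forall m : mp_type, is_primary m -> ~~ mp_cyclic m),
      (forall m : mp_type, ~~ mp_cyclic m ->
         derived m (fun mv => is_primary_move mv || is_PS mv && ~~ cyclic mv)),
      (forall m : mp_type, mp_cyclic m -> ~ derived m (fun mv => ~~ cyclic mv))
    & (forall (m : mp_type) (s : seq (otmove * bool)), mp_cyclic m ->
         all (fun r => is_primary_move r.1 || is_PS r.1) s ->
         represents_mp s m ->
         has (fun r => is_PS r.1 && cyclic r.1) s)].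
Proof.
split.
- exact: primary_noncyclic.
- by move=> m /certificateP/chain_derived.
- by move=> m cm [s [nc /(cyclic_mp_not_represented cm)/negP]].
(* Without a cyclic sliding move, the sequence would be entirely non-cyclic, because the primary MP
   move is. *)
- move=> m s cm ok /(cyclic_mp_not_represented cm); apply: contraNT.
  rewrite -all_predC => nps; have := conj ok nps.
  move/andP; rewrite -all_predI; apply: sub_all => -[[m'|k] d] /=; last by [].
  by rewrite orbF andbT; exact: primary_noncyclic.
Qed.
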